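(* Let $\mu$ be a positive regular Borel measure on $\mathbb{C}_+$ and $2\le q<\infty$. Then the following are equivalent: (1) The Laplace--Carleson embedding $\mathcal{L}\colon L^\infty(0,\infty)\to L^q(\mathbb{C}_+,d\mu)$ is bounded. (2) $\displaystyle\sum_{n\in\mathbb{Z}}\mathcal{C}_q[\mu_n]<\infty$. (3) $\displaystyle\int_0^\infty \frac1t\,\mathcal{C}_q[\mu](t)\,dt<\infty$. If $\alpha>-1$ and $q<4+2\alpha$, then (1)--(3) are also equivalent to (4) $\displaystyle\int_0^\infty t^{1-q}\sup_{\operatorname{Re}z=t}\widetilde B_\alpha\mu(z)\,dt<\infty$. If $\alpha>-1$ and $q<4+\alpha$, then (1)--(3) are also equivalent to (5) $\displaystyle\int_0^\infty t^{1-q}\sup_{\operatorname{Re}z=t}B_\alpha\mu(z)\,dt<\infty$. Furthermore, the sum in (2) and the integrals in (3), (4), (5) (the latter two under the respective conditions on $\alpha$ and $q$) are comparable to $\|\mathcal{L}\colon L^\infty(0,\infty)\to L^q(\mathbb{C}_+,d\mu)\|^q$, with implied constants depending only on $q$ and $\alpha$.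
   Context: $\mathbb{C}_+=\{z\in\mathbb{C}:\operatorname{Re}z>0\}$. The Laplace transform of a function $f$ on $(0,\infty)$ is $\mathcal{L}f(z)=\int_0^\infty e^{-zt}f(t)\,dt$, $z\in\mathbb{C}_+$. The operator norm of $\mathcal{L}$ is taken to be $\infty$ if the map is not bounded. For an interval $I\subset i\mathbb{R}$ with length $|I|\in(0,\infty)$, the Carleson square is $Q_I=\{x+iy: iy\in I,\ 0<x\le|I|\}$. For a positive regular Borel measure $\mu$ on $\mathbb{C}_+$ and $\beta>0$, $$\mathcal{C}_\beta[\mu]=\sup_{I\subset i\mathbb{R}\text{ interval}}\frac{\mu(Q_I)}{|I|^\beta},\qquad \mathcal{C}_\beta[\mu](t)=\sup_{I\subset i\mathbb{R}\text{ interval},\,|I|=t}\frac{\mu(Q_I)}{t^\beta}\quad(t>0).$$ For $n\in\mathbb{Z}$ let $S_n=\{x+iy: y\in\mathbb{R},\ 2^n\le x<2^{n+1}\}$ and $\mu_n(E)=\mu(E\cap S_n)$. For $\alpha>-1$ and $z\in\mathbb{C}_+$, $$B_\alpha\mu(z)=\int_{\mathbb{C}_+}\frac{(\operatorname{Re}z)^{2+\alpha}}{|w+\bar z|^{4+2\alpha}}(\operatorname{Re}w)^\alpha\,d\mu(w),\qquad \widetilde B_\alpha\mu(z)=\int_{\mathbb{C}_+}\frac{(\operatorname{Re}z)^{2+2\alpha}}{|w+\bar z|^{4+2\alpha}}\,d\mu(w).$$ *)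

(* Defs.v *)
From HB Require Import structures.
From mathcomp Require Import all_boot all_order all_algebra.
From mathcomp Require Import complex.
From mathcomp Require Import all_classical all_reals all_analysis.

Set Implicit Arguments.
Unset Strict Implicit.
Unset Printing Implicit Defensive.

Import Order.TTheory GRing.Theory Num.Theory.
Import numFieldNormedType.Exports.

Local Open Scope classical_set_scope.
Local Open Scope ring_scope.
Local Open Scope complex_scope.

(** The domain [C] is identified with the Borel space [R * R] through
    [(x, y) |-> x + iy]; function values live in [R[i]].  A measure on the
    open half-plane is a measure on [R * R] that vanishes outside it. *)

Section half_plane.
Context {R : realType}.

Definition toC (w : R * R) : R[i] := w.1 +i* w.2.

Definition Cplus : set (R * R) := [set w | 0 < w.1].

Definition posreals : set R := `]0, +oo[%classic.

(** Regularity of every Borel subset of the half-plane, both from outside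
    and from inside; local finiteness is not required. *)
Definition regular_borel_on_Cplus (mu : {measure set (R * R) -> \bar R}) : Prop :=
  mu (~` Cplus) = 0%E /\
  forall E : set (R * R), measurable E -> E `<=` Cplus ->
    mu E = ereal_inf
      [set mu U | U in [set U | [/\ open U, E `<=` U & U `<=` Cplus]]] /\
    mu E = ereal_sup [set mu K | K in [set K | compact K /\ K `<=` E]].

End half_plane.

Section complex_Lp.
Context d {T : measurableType d} {R : realType}.
Variable mu : {measure set T -> \bar R}.

Definition cintegral (D : set T) (g : T -> R[i]) : R[i] :=
  (\int[mu]_(x in D) complex.Re (g x)) +i* (\int[mu]_(x in D) complex.Im (g x)).

Definition cmeasurable (D : set T) (g : T -> R[i]) : Prop :=
  measurable_fun D (fun x => complex.Re (g x)) /\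
  measurable_fun D (fun x => complex.Im (g x)).

(** Extending [|g|] by zero outside [D] gives the norm of [L^p(D, mu)], also
    for [p = +oo], since [|g|] is nonnegative. *)
Definition cLnorm (D : set T) (p : \bar R) (g : T -> R[i]) : \bar R :=
  'N[mu]_p[(fun x => (Normc.normc (g x))%:E) \_ D]%E.

Definition cLspace (D : set T) (p : \bar R) (g : T -> R[i]) : Prop :=
  cmeasurable D g /\ (cLnorm D p g < +oo)%E.

End complex_Lp.

Section laplace.
Context {R : realType}.

Definition cexp (z : R[i]) : R[i] :=
  (expR (complex.Re z))%:C * (cos (complex.Im z) +i* sin (complex.Im z)).

Definition laplace (f : R -> R[i]) (z : R[i]) : R[i] :=
  cintegral lebesgue_measure posreals (fun t => cexp (- z * t%:C) * f t).

Variables (mu : {measure set (R * R) -> \bar R}) (q : R).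

Definition laplace_bounded_by (M : R) : Prop :=
  forall f : R -> R[i], cLspace lebesgue_measure posreals +oo%E f ->
    cLspace mu Cplus q%:E (fun w => laplace f (toC w)) /\
    (cLnorm mu Cplus q%:E (fun w => laplace f (toC w)) <=
      M%:E * cLnorm lebesgue_measure posreals +oo%E f)%E.

Definition laplace_bounded : Prop :=
  exists M : R, 0 <= M /\ laplace_bounded_by M.

(** Equal to [+oo] when there is no admissible bound. *)
Definition laplace_opnorm : \bar R :=
  ereal_inf [set M%:E | M in [set M : R | 0 <= M /\ laplace_bounded_by M]].

End laplace.

Section carleson.
Context {R : realType}.
Implicit Types (J : interval R) (nu : set (R * R) -> \bar R).

(** [J] is the set of imaginary parts of the interval [I] in [iR]. *)
Definition ilength J : \bar R := lebesgue_measure [set` J].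

Definition carleson_square J : set (R * R) :=
  [set w | [/\ w.2 \in J, 0 < w.1 & (w.1%:E <= ilength J)%E]].

Definition carleson (beta : R) nu : \bar R :=
  ereal_sup [set (nu (carleson_square J) / (ilength J `^ beta))%E
            | J in [set J | (0 < ilength J < +oo)%E]].

Definition carleson_at (beta : R) nu (t : R) : \bar R :=
  ereal_sup [set (nu (carleson_square J) / (t `^ beta)%:E)%E
            | J in [set J | ilength J = t%:E]].

Definition strip (n : int) : set (R * R) :=
  [set w | (2 : R) ^ n <= w.1 < (2 : R) ^ (n + 1)].

Definition restr_strip nu (n : int) : set (R * R) -> \bar R :=
  fun E => nu (E `&` strip n).

End carleson.

Section berezin.
Context {R : realType}.
Variables (alpha : R) (mu : {measure set (R * R) -> \bar R}).

Definition berezin (z : R * R) : \bar R :=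
  (\int[mu]_(w in Cplus)
    (z.1 `^ (2 + alpha)
      / Normc.normc (toC w + (toC z)^*) `^ (4 + 2 * alpha)
      * w.1 `^ alpha)%:E)%E.

Definition berezin_tilde (z : R * R) : \bar R :=
  (\int[mu]_(w in Cplus)
    (z.1 `^ (2 + 2 * alpha)
      / Normc.normc (toC w + (toC z)^*) `^ (4 + 2 * alpha))%:E)%E.

End berezin.

Section conditions.
Context {R : realType}.
Variables (q : R) (mu : {measure set (R * R) -> \bar R}).

Definition carleson_sum : \bar R :=
  \esum_(n in [set: int]) carleson q (restr_strip mu n).

Definition carleson_integral : \bar R :=
  (\int[lebesgue_measure]_(t in posreals)
    ((t^-1)%:E * carleson_at q mu t))%E.

Definition line_sup_integral (B : R * R -> \bar R) : \bar R :=
  (\int[lebesgue_measure]_(t in posreals)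
    ((t `^ (1 - q))%:E * ereal_sup [set B z | z in [set z | z.1 = t]]))%E.

End conditions.

Definition comparable_with {R : realType} (c C : R) (a b : \bar R) : Prop :=
  (c%:E * a <= b)%E /\ (b <= C%:E * a)%E.

(* Main.v *)
Require Import Defs.
From mathcomp Require Import all_boot all_order all_algebra.
From mathcomp Require Import complex.
From mathcomp Require Import all_classical all_reals all_analysis.
From mathcomp Require Import measurable_realfun ess_sup_inf.
From mathcomp Require Import ring lra zify.
Set Implicit Arguments.
Unset Strict Implicit.
Unset Printing Implicit Defensive.
Import Order.TTheory GRing.Theory Num.Theory.
Import numFieldNormedType.Exports.
Local Open Scope classical_set_scope.
Local Open Scope ring_scope.

(** Cut the half-plane into the strips [S_n], and let [box n y] be the square of
    side [2 ^ n] in [S_n] over the heights from [y] to [y + 2 ^ n]. All the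
    quantities of the theorem are comparable to

      [dyadic_sum mu q = sum_n 2 ^ (- n q) sup_y mu (box n y)].

    Carleson conditions. A Carleson square of side [l] meets the strip [S_n]
    only if [2 ^ n <= l], in a set covered by about [l / 2 ^ n] boxes, and it
    contains a box of side comparable to [l]. Since [q > 1], the contributions
    of the lower strips to the Carleson constant at scale [t] form a geometric
    convolution ([carleson_at_le]), whose integral against [dt / t] is a
    multiple of [dyadic_sum] ([dyadic_integral_le]).

    Berezin conditions. Both kernels have the form
    [z.1 ^ a w.1 ^ b / |w + conj z| ^ (a + b + 2)]. Summing their values over
    the boxes of a strip again leads to a convolution in the index of the strip
    ([bintegral_le]); it is summable because of the condition that
    relates [q] to [alpha] ([bkernel_decay]). The box next to [z] alone gives
    the converse inequality.

    Upper bound for the embedding. Let [h = 2 ^ n] and take one point [z_k] in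
    each box [box n (k h)]. Then [sum_k |L f (z_k)| ^ 2] is at most a constant
    times [h ^ (-2)] times the square of the supremum norm of [f]
    ([laplace_large_sieve]). By duality this is a bound on the Gram matrix of
    the exponentials [exp (- z_k t)] in a weighted [L^2] space; for the weight
    [(t + 1 / h) exp (h t)] on [[- 1 / h, +oo)], which vanishes at the left
    endpoint, its entries decay like [1 / (j - k) ^ 2], so the row sums are
    bounded ([weighted_bessel]). Since [q >= 2], one has
    [|L f| ^ q <= (sup |L f|) ^ (q - 2) |L f| ^ 2] on the strip, and choosing
    nearly maximal points [z_k] gives [laplace_integral_le].

    Lower bound for the embedding. For a set of indices [n] with gaps at least
    [16] and any heights [y n], the function equal to [exp (i (y n) t)] for
    [1 / 4 <= 2 ^ n t < 1 / 2] and to zero elsewhere has modulus at most one,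
    and its Laplace transform is at least a constant times [2 ^ (- n)] on all the boxes
    [box n (y n)] simultaneously ([laplace_lacunary_ge]). Choosing boxes of
    nearly maximal mass and adding up the [16] residue classes of indices bounds
    [dyadic_sum] by the [q]-th power of the norm ([dyadic_sum_le_bound]). *)

(** * Sums of extended reals and integrals of non-measurable functions *)

Section integral_bounds.
Context d (T : measurableType d) (R : realType).
Variable mu : {measure set T -> \bar R}.
Local Open Scope ereal_scope.

(** No measurability is needed, the integral of a nonnegative function being
    the supremum of the integrals of the simple functions below it. *)
Lemma ge0_le_integral_nonmeas (D : set T) (f g : T -> \bar R) :
  (forall x, D x -> 0 <= f x) -> (forall x, D x -> f x <= g x) ->
  \int[mu]_(x in D) f x <= \int[mu]_(x in D) g x.
Proof.
move=> f0 fg.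
have g0 x : D x -> 0 <= g x by move=> Dx; exact: le_trans (f0 x Dx) (fg x Dx).
rewrite !ge0_integralE//; apply: le_ereal_sup => _ [h /= hf <-].
exists h => //= x; apply: le_trans (hf x) _; rewrite /patch.
by case: ifPn => //; rewrite inE => /fg.
Qed.

Lemma integral_cst_patch (B : set T) (r : \bar R) : measurable B ->
  \int[mu]_x ((cst r) \_ B) x = r * mu B.
Proof. by move=> mB; rewrite -integral_mkcond integral_cst. Qed.

Lemma measurable_cst_patch (B : set T) (r : \bar R) : measurable B ->
  measurable_fun [set: T] ((cst r) \_ B).
Proof.
by move=> mB; apply/(measurable_restrictT _ mB).
Qed.

End integral_bounds.

Section esum_lemmas.
Context (R : realType).
Local Open Scope ereal_scope.

Lemma esum_le_seq (I : choiceType) (a : I -> \bar R) (M : \bar R) :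
  (forall s : seq I, uniq s -> \sum_(i <- s) a i <= M) ->
  (\esum_(i in [set: I]) a i) <= M.
Proof.
move=> h; apply: ge_ereal_sup => /= _ [X [finX _] <-].
by rewrite fsbig_finite//=; exact: h.
Qed.

Lemma seq_le_esum (I : choiceType) (a : I -> \bar R) (s : seq I) : uniq s ->
  \sum_(i <- s) a i <= \esum_(i in [set: I]) a i.
Proof.
move=> us; apply: esum_ge; exists [set` s] => //.
by rewrite fsbig_seq.
Qed.

(** A sum over a countable type is a series along its enumeration. *)
Lemma esum_nneseries (I : countType) (a : I -> \bar R) :
  (forall i, 0 <= a i) ->
  \sum_(k <oo) (if pickle_inv k is Some i then a i else 0) =
  \esum_(i in [set: I]) a i.
Proof.
move=> a0; rewrite nneseries_esumT; last by move=> k; case: pickle_inv.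
set phi := (fun k => _).
rewrite (_ : (\esum_(i in [set: I]) a i) = \esum_(i in [set: I]) phi (pickle i)).
  rewrite -(@reindex_esum _ _ _ [set: I] (range (@pickle I)) _ phi); last first.
    by split => // x y _ _; exact: pcan_inj (@pickleK_inv I) x y.
  rewrite [RHS]esum_mkcond; apply: eq_esum => k _; case: ifPn => //.
  rewrite notin_setE => kn; rewrite /phi; case E : pickle_inv => [i|]//.
  exfalso; apply: kn; exists i => //.
  by have := @pickle_invK I k; rewrite /ocancel E.
by apply: eq_esum => i _; rewrite /phi pickleK_inv.
Qed.

Lemma esumZr_le (I : choiceType) (a : I -> \bar R) (c : \bar R) :
  0 <= c -> (forall i, 0 <= a i) ->
  (\esum_(i in [set: I]) (a i * c)) <= (\esum_(i in [set: I]) a i) * c.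
Proof.
move=> c0 a0; apply: esum_le_seq => s us.
by rewrite -ge0_sume_distrl//; apply: (lee_wpmul2r c0); exact: seq_le_esum.
Qed.

Lemma esumZl_le (I : choiceType) (a : I -> \bar R) (c : \bar R) :
  0 <= c -> (forall i, 0 <= a i) ->
  (\esum_(i in [set: I]) (c * a i)) <= c * \esum_(i in [set: I]) a i.
Proof.
move=> c0 a0; under eq_esum do rewrite muleC.
by rewrite muleC; exact: esumZr_le.
Qed.

Lemma esumZl_ge (I : choiceType) (a : I -> \bar R) (r : R) :
  (0 < r)%R -> (forall i, 0 <= a i) ->
  r%:E * (\esum_(i in [set: I]) a i) <= \esum_(i in [set: I]) (r%:E * a i).
Proof.
move=> r0 a0; rewrite muleC -lee_pdivlMr// muleC.
rewrite (eq_esum (b := fun i => r^-1%:E * (r%:E * a i))); last first.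
  by move=> i _; rewrite muleA -EFinM mulVf ?gt_eqF// mul1e.
apply: esumZl_le => [|i]; first by rewrite lee_fin invr_ge0 ltW.
by rewrite mule_ge0// lee_fin ltW.
Qed.

(** Over [int], a translation of the index does not change a sum. *)
Lemma esum_shift (a : int -> \bar R) (j : int) :
  (\esum_(n in [set: int]) a (n + j)%R) = \esum_(n in [set: int]) a n.
Proof.
symmetry; apply: (reindex_esum [set: int] [set: int] (fun n => n + j)%R a).
split => //; first by move=> x y _ _; exact: addIr.
by move=> y _; exists (y - j)%R => //; rewrite subrK.
Qed.

(** Tonelli's theorem for sums. *)
Lemma esum_pair (I J : choiceType) (a : I * J -> \bar R) : (forall p, 0 <= a p) ->
  (\esum_(p in [set: I * J]) a p) =
  \esum_(i in [set: I]) \esum_(j in [set: J]) a (i, j).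
Proof.
move=> a0; rewrite esum_esum//.
have -> : [set: I] `*`` (fun=> [set: J]) = [set: I * J] by apply/seteqP; split.
by apply: eq_esum => -[i j] _.
Qed.

(** Young's inequality for the convolution of two summable families. *)
Lemma esum_conv_le (k a : int -> \bar R) :
  (forall n, 0 <= k n) -> (forall n, 0 <= a n) ->
  (\esum_(m in [set: int]) \esum_(n in [set: int]) (k (m - n)%R * a n)) <=
  (\esum_(n in [set: int]) k n) * (\esum_(n in [set: int]) a n).
Proof.
move=> k0 a0; rewrite esum_esum; last by move=> *; exact: mule_ge0.
rewrite (reindex_esum ([set: int] `*`` (fun=> [set: int])) _
  (fun p => (p.2, p.1))); last first.
  split => //.
  - by move=> [x1 x2] [y1 y2] _ _ /= [-> ->].
  - by move=> [y1 y2] _; exists (y2, y1).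
rewrite -(esum_esum (a := fun n m => k (m - n)%R * a n)); last first.
  by move=> *; exact: mule_ge0.
have K0 : 0 <= \esum_(n in [set: int]) k n by exact: esum_ge0.
apply: le_trans (esumZl_le K0 a0).
apply: le_esum => n _; apply: le_trans (esumZr_le _ _) _ => //.
by rewrite (esum_shift k).
Qed.

(** A finite supremum of nonnegative values is attained up to the factor [2]. *)
Lemma ereal_sup_near (S : set (\bar R)) : S !=set0 -> (forall x, S x -> 0 <= x) ->
  ereal_sup S < +oo -> exists2 x, S x & ereal_sup S <= 2%:E * x.
Proof.
move=> [x0 Sx0] S0 Soo.
have s0 : 0 <= ereal_sup S.
  by apply: le_trans (S0 _ Sx0) _; exact: ereal_sup_ubound.
have sfin : ereal_sup S \is a fin_num by rewrite ge0_fin_numE.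
have [sE|sneq] := eqVneq (ereal_sup S) 0.
  by exists x0 => //; rewrite sE mule_ge0// S0.
have sgt : 0 < ereal_sup S by rewrite lt_neqAle eq_sym sneq.
move: (sfin) sgt => /fineK <-; rewrite lte_fin => sgt.
have [y Sy hy] : exists2 y, S y & (fine (ereal_sup S) / 2)%:E < y.
  apply: ereal_sup_gt; rewrite -[ltRHS]fineK// lte_fin ltr_pdivrMr//.
  by rewrite mulr_natr mulr2n ltrDl.
exists y => //.
have : 2%:E * (fine (ereal_sup S) / 2)%:E <= 2%:E * y.
  by apply: lee_wpmul2l; [rewrite lee_fin|exact: ltW].
by rewrite -EFinM mulrC divfK.
Qed.

End esum_lemmas.

Section cover.
Context d (T : measurableType d) (R : realType).
Variable mu : {measure set T -> \bar R}.
Local Open Scope ereal_scope.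

(** Upper sum over a countable measurable cover; [G] need not be measurable. *)
Lemma integral_le_cover (I : countType) (D : set T) (B : I -> set T)
    (G : T -> \bar R) (g : I -> \bar R) :
  (forall i, measurable (B i)) -> (forall x, D x -> exists i, B i x) ->
  (forall x, D x -> 0 <= G x) -> (forall i, 0 <= g i) ->
  (forall i x, D x -> B i x -> G x <= g i) ->
  \int[mu]_(x in D) G x <= \esum_(i in [set: I]) (g i * mu (B i)).
Proof.
move=> mB DB G0 g0 Gg.
pose F k : T -> \bar R :=
  if pickle_inv k is Some i then (cst (g i)) \_ (B i) else cst 0.
have F0 k x : 0 <= F k x.
  rewrite /F; case: pickle_inv => [i|]//.
  by apply: erestrict_ge0 => t _ /=.
have mF k : measurable_fun [set: T] (F k).
  by rewrite /F; case: pickle_inv => [i|]//; exact: measurable_cst_patch.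
rewrite integral_mkcond.
apply: (@le_trans _ _ (\int[mu]_x \sum_(k <oo) F k x)).
  apply: ge0_le_integral_nonmeas => x _; first exact: erestrict_ge0.
  rewrite /patch; case: ifPn => [|_]; last exact: nneseries_ge0.
  rewrite inE => Dx; have [i Bix] := DB _ Dx.
  apply: le_trans (Gg _ _ Dx Bix) _.
  have -> : g i = F (pickle i) x.
    by rewrite /F pickleK_inv /patch mem_set.
  rewrite nneseries_esumT//.
  by have := @seq_le_esum _ _ (F^~ x) [:: pickle i] isT; rewrite big_seq1.
rewrite integral_nneseries// -(esum_nneseries (a := fun i => g i * mu (B i))).
  apply: lee_nneseries => k _; first by rewrite integral_ge0.
  rewrite /F; case: pickle_inv => [i|]; last by rewrite integral0.
  by rewrite integral_cst_patch.
by move=> i; rewrite mule_ge0.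
Qed.

(** Lower sum over a disjoint family of measurable subsets. *)
Lemma packing_le_integral (I : choiceType) (D : set T) (B : I -> set T)
    (G : T -> \bar R) (g : I -> \bar R) :
  (forall i, measurable (B i)) -> (forall i, B i `<=` D) ->
  (forall i j x, B i x -> B j x -> i = j) ->
  (forall x, D x -> 0 <= G x) -> (forall i, 0 <= g i) ->
  (forall i x, B i x -> g i <= G x) ->
  (\esum_(i in [set: I]) (g i * mu (B i))) <= \int[mu]_(x in D) G x.
Proof.
move=> mB BD tB G0 g0 gG; apply: esum_le_seq => s us.
under eq_bigr do rewrite -integral_cst_patch//.
rewrite -ge0_integral_sum//; last 2 first.
- by move=> i; exact: measurable_cst_patch.
- by move=> i x _; apply: erestrict_ge0 => t _ /=.
rewrite [leRHS]integral_mkcond.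
apply: ge0_le_integral_nonmeas => x _.
  by apply: sume_ge0 => i _; apply: erestrict_ge0 => t _ /=.
have [[i [si Bix]]|no] := pselect (exists i, i \in s /\ B i x).
  rewrite (bigD1_seq i)//= big1 ?adde0; last first.
    move=> j ji; rewrite /patch memNset// => Bjx.
    by move/eqP : ji; apply; exact: tB Bjx Bix.
  rewrite /patch !mem_set//; [exact: gG|exact: BD Bix].
rewrite big_seq big1 ?erestrict_ge0// => i si.
by rewrite /patch memNset// => Bix; apply: no; exists i.
Qed.

End cover.

Lemma cst_measure_le_integral d (T : measurableType d) (R : realType)
    (mu : {measure set T -> \bar R}) (D B : set T) (r : \bar R) (G : T -> \bar R) :
  measurable B -> B `<=` D -> (0 <= r)%E -> (forall x, D x -> 0 <= G x)%E ->
  (forall x, B x -> r <= G x)%E -> (r * mu B <= \int[mu]_(x in D) G x)%E.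
Proof.
move=> mB BD r0 G0 rG; rewrite -integral_cst_patch// [leRHS]integral_mkcond.
apply: ge0_le_integral_nonmeas => x _; first by apply: erestrict_ge0.
rewrite {1}/patch; case: ifPn => [/set_mem Bx|_]; last exact: erestrict_ge0.
by rewrite /patch mem_set; [exact: rG|exact: BD].
Qed.
(** * Dyadic boxes *)

Section dyadic.
Context {R : realType}.

(** The left edge of the [n]-th dyadic strip. *)
Definition dyad (n : int) : R := 2 ^ n.

Lemma dyad_gt0 n : 0 < dyad n.
Proof. exact: exprz_gt0. Qed.

Lemma dyad_ge0 n : 0 <= dyad n.
Proof. exact/ltW/dyad_gt0. Qed.

Lemma dyad_neq0 n : dyad n != 0.
Proof. by rewrite gt_eqF// dyad_gt0. Qed.

Hint Resolve dyad_gt0 dyad_ge0 dyad_neq0 : core.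

Lemma dyadD m n : dyad (m + n) = dyad m * dyad n.
Proof. by rewrite /dyad expfzDr. Qed.

Lemma dyadS n : dyad (n + 1) = 2 * dyad n.
Proof. by rewrite dyadD mulrC /dyad expr1z. Qed.

Lemma dyad0 : dyad 0 = 1.
Proof. by rewrite /dyad expr0z. Qed.

Lemma dyadB m n : dyad (m - n) = dyad m / dyad n.
Proof. by rewrite -[in RHS](subrK n m) [in RHS]dyadD mulfK. Qed.

Lemma dyad_powR n : dyad n = 2 `^ n%:~R.
Proof. by rewrite powR_intmul. Qed.

Lemma le_dyad m n : (m <= n)%R -> dyad m <= dyad n.
Proof. by move=> mn; rewrite !dyad_powR ler_powR ?ler1n ?ler_int. Qed.

Lemma lt_dyad m n : (m < n)%R -> dyad m < dyad n.
Proof.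
rewrite -lezD1 => /le_dyad; apply: lt_le_trans.
by rewrite dyadS mulr_natl mulr2n ltrDl.
Qed.

Lemma dyad_lt_inv m n : dyad m < dyad n -> (m < n)%R.
Proof. by apply: contraTT; rewrite -!leNgt => /le_dyad. Qed.

Lemma dyad_ex (x : R) : 0 < x -> exists n, dyad n <= x < dyad (n + 1).
Proof.
move=> x0; have ln2 : 0 < ln (2 : R) by rewrite ln_gt0// ltr1n.
exists (Num.floor (ln x / ln 2)).
have /andP[h1 h2] := floor_itv (ln x / ln 2).
rewrite !dyad_powR /powR pnatr_eq0/= -{2 3}(lnK x0) ler_expR ltr_expR.
by rewrite -ler_pdivlMr// h1 -ltr_pdivrMr.
Qed.

Lemma dyad_uniq (x : R) m n :
  dyad m <= x < dyad (m + 1) -> dyad n <= x < dyad (n + 1) -> m = n.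
Proof.
move=> /andP[h1 h2] /andP[h3 h4]; apply/eqP; rewrite eq_le.
rewrite -!ltzD1; apply/andP; split.
  exact: dyad_lt_inv (le_lt_trans h1 h4).
exact: dyad_lt_inv (le_lt_trans h3 h2).
Qed.

Lemma powR_dyadB m n (s : R) :
  (dyad (m - n)) `^ s = (dyad m) `^ s / (dyad n) `^ s.
Proof.
rewrite dyadB powRM ?invr_ge0//; congr (_ * _).
by rewrite -(powR_inv1 (dyad_ge0 n)) -powRrM mulN1r powRN.
Qed.

(** The half-open square of side [2 ^ n] with lower left corner
    [2 ^ n + i y]. *)
Definition box (n : int) (y : R) : set (R * R) :=
  [set w | dyad n <= w.1 < dyad (n + 1) /\ y <= w.2 < y + dyad n].

Lemma boxE n y : box n y =
  `[dyad n, dyad (n + 1)[%classic `*` `[y, y + dyad n[%classic.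
Proof.
by apply/seteqP; split => w /=; rewrite !in_itv.
Qed.

Lemma measurable_box n y : measurable (box n y).
Proof. by rewrite boxE; apply: measurableX; exact: measurable_itv. Qed.

Lemma box_Cplus n y : box n y `<=` Cplus.
Proof. by move=> w [/andP[+ _] _]; exact: lt_le_trans. Qed.

Lemma measurable_strip n : measurable (strip n : set (R * R)).
Proof.
rewrite [X in measurable X](_ : _ = `[dyad n, dyad (n + 1)[%classic `*` setT).
  by apply: measurableX => //; exact: measurable_itv.
by apply/seteqP; split => w /=; rewrite in_itv/= /strip/=; [|case].
Qed.

Lemma strip_box n (w : R * R) : strip n w ->
  exists k : int, box n (k%:~R * dyad n) w.
Proof.
move=> nw; exists (Num.floor (w.2 / dyad n)); split => //.
have /andP[h1 h2] := floor_itv (w.2 / dyad n).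
rewrite -ler_pdivlMr// h1/=.
by rewrite -[X in _ + X]mul1r -mulrDl -ltr_pdivrMr// -(intrD _ _ 1).
Qed.

End dyadic.
#[global] Hint Extern 0 (is_true (0 < dyad _)) => solve [exact: dyad_gt0] : core.
#[global] Hint Extern 0 (is_true (0 <= dyad _)) => solve [exact: dyad_ge0] : core.
#[global] Hint Extern 0 (is_true (dyad _ != 0)) => solve [exact: dyad_neq0] : core.

Section box_mass.
Context {R : realType}.
Variable mu : {measure set (R * R) -> \bar R}.
Local Open Scope ereal_scope.

(** The largest mass of a box in the [n]-th strip. *)
Definition box_mass (n : int) : \bar R := ereal_sup [set mu (box n y) | y in setT].

Lemma box_le_mass n y : mu (box n y) <= box_mass n.
Proof. by apply: ereal_sup_ubound; exists y. Qed.

Lemma box_mass_ge0 n : 0 <= box_mass n.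
Proof. exact: le_trans (measure_ge0 _ _) (box_le_mass n 0%R). Qed.

(** The largest mass normalized by the [q]-th power of the side. *)
Definition box_density (q : R) (n : int) : \bar R :=
  ((dyad n) `^ (- q))%:E * box_mass n.

(** The quantity to which all the others are compared. *)
Definition dyadic_sum (q : R) : \bar R := \esum_(n in [set: int]) box_density q n.

Lemma box_density_ge0 q n : 0 <= box_density q n.
Proof. by rewrite mule_ge0 ?lee_fin ?powR_ge0// box_mass_ge0. Qed.

Lemma box_massE q n : box_mass n = ((dyad n) `^ q)%:E * box_density q n.
Proof.
by rewrite /box_density muleA -EFinM -powRD ?dyad_neq0 ?implybT// subrr powRr0 mul1e.
Qed.

Lemma dyadic_sum_ge0 q : 0 <= dyadic_sum q.
Proof. by apply: esum_ge0 => n _; exact: box_density_ge0. Qed.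

End box_mass.
(** * The Carleson conditions *)

Section carleson_box.
Context {R : realType}.
Local Open Scope ereal_scope.

(** The endpoints of [J] may be open or closed. *)
Lemma ilength_itv (J : interval R) (l : R) : ilength J = l%:E -> (0 < l)%R ->
  exists a : R, forall y, y \in J -> (a <= y <= a + l)%R.
Proof.
rewrite /ilength lebesgue_measure_itv; case: ifPn => [|_ [<-]]; last by rewrite ltxx.
case: J => [[b1 a|[]] [b2 c|[]]]//= ac [<-] _; exists a => y.
rewrite addrCA subrr addr0 => /itvP h.
by case: b1 b2 h => [] [] h; rewrite ?h// ltW ?h.
Qed.

Lemma measurable_carleson_square (J : interval R) :
  (0 < ilength J < +oo) -> measurable (carleson_square J).
Proof.
move=> /andP[J0 Joo].
have Jfin : ilength J \is a fin_num by rewrite ge0_fin_numE// ltW.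
rewrite [X in measurable X](_ : _ =
  `]0%R, fine (ilength J)]%classic `*` [set` J]); last first.
  apply/seteqP; split => w /=; rewrite in_itv/=.
    by move=> [-> -> +]; rewrite -[X in _ <= X]fineK// lee_fin => ->.
  by move=> [/andP[h1 h2] h3]; split => //; rewrite -[X in _ <= X]fineK// lee_fin.
by apply: measurableX; exact: measurable_itv.
Qed.

Variable mu : {measure set (R * R) -> \bar R}.

(** A Carleson square of side [l >= 2 ^ n] meets the [n]-th strip in a set
    covered by at most [2 l / 2 ^ n] boxes. *)
Lemma carleson_square_strip_le (J : interval R) (l : R) n :
  ilength J = l%:E -> (0 < l)%R ->
  mu (carleson_square J `&` strip n) <=
    (if (dyad n <= l)%R then (2 * l / dyad n)%:E * box_mass mu n else 0).
Proof.
move=> Jl l0; have [a aJ] := ilength_itv Jl l0.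
have mQ : measurable (carleson_square J `&` strip n).
  apply: measurableI; last exact: measurable_strip.
  by apply: measurable_carleson_square; rewrite Jl lte_fin l0 ltry.
case: ifPn => [nl|]; last first.
  rewrite -ltNge => ln; rewrite (_ : _ `&` _ = set0) ?measure0//.
  rewrite -subset0 => w /= [[_ _]]; rewrite Jl lee_fin => wl /andP[nw _].
  by move: (le_lt_trans (le_trans nw wl) ln); rewrite ltxx.
(* [N] boxes stacked upwards from height [a] cover the part of the square. *)
pose N := (Num.truncn (l / dyad n)).+1.
have lN : (l < N%:R * dyad n)%R.
  rewrite -ltr_pdivrMr//; have := truncnS_gt (l / dyad n); exact.
have NL : (N%:R <= 2 * l / dyad n)%R.
  rewrite /N -natr1.
  have h1 : ((Num.truncn (l / dyad n))%:R <= l / dyad n)%R.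
    by rewrite truncn_le// divr_ge0// ltW.
  have h2 : (1 <= l / dyad n)%R by rewrite ler_pdivlMr// mul1r.
  by rewrite -mulrA mulr_natl mulr2n lerD.
apply: (@le_trans _ _ (\sum_(k < N) mu (box n (a + k%:R * dyad n)%R))).
  apply: (@content_subadditive _ _ _ mu _ (fun k : nat => box n (a + k%:R * dyad n)%R) N) => //.
    by move=> k _; exact: measurable_box.
  rewrite -(bigcup_mkord N (fun k : nat => box n (a + k%:R * dyad n)%R)).
  move=> w /= [[wJ _ _] nw].
  have /andP[h1 h2] := aJ _ wJ.
  exists (Num.truncn ((w.2 - a) / dyad n)) => /=.
    rewrite ltnS; apply: le_truncn; rewrite ler_pM2r ?invr_gt0//.
    by rewrite lerBlDl.
  split => //; apply/andP; split.
    rewrite -lerBrDl -ler_pdivlMr// truncn_le// divr_ge0// subr_ge0//.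
  rewrite -addrA -[X in (_ + (_ + X))%R]mul1r -mulrDl natr1 -ltrBlDl -ltr_pdivrMr//.
  exact: truncnS_gt.
apply: (@le_trans _ _ (\sum_(k < N) box_mass mu n)).
  by apply: lee_sum => k _; exact: box_le_mass.
under eq_bigr do rewrite -(mul1e (box_mass mu n)).
rewrite -ge0_sume_distrl// sumEFin sumr_const card_ord.
by apply: lee_wpmul2r; rewrite ?lee_fin// box_mass_ge0.
Qed.

Lemma carleson_square_sum_le (J : interval R) (l : R) :
  ilength J = l%:E -> (0 < l)%R ->
  mu (carleson_square J) <= \esum_(n in [set: int])
    (if (dyad n <= l)%R then (2 * l / dyad n)%:E * box_mass mu n else 0).
Proof.
move=> Jl l0.
have mJ : measurable (carleson_square J).
  by apply: measurable_carleson_square; rewrite Jl lte_fin l0 ltry.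
have <- : \int[mu]_(w in carleson_square J) cst 1 w = mu (carleson_square J).
  by rewrite integral_cst// mul1e.
apply: le_trans (@integral_le_cover _ _ _ mu _ _
  (fun n => carleson_square J `&` strip n) _ (fun=> 1) _ _ _ _ _) _ => //.
- by move=> n; apply: measurableI => //; exact: measurable_strip.
- by move=> w Jw; have [_ /dyad_ex[n nw] _] := Jw; exists n.
- apply: le_esum => n _; rewrite mul1e; exact: carleson_square_strip_le.
Qed.

Lemma ilength_bnd (y l : R) : (0 < l)%R -> ilength `[y, (y + l)%R[ = l%:E.
Proof.
by move=> l0; rewrite /ilength lebesgue_measure_itv/= lte_fin ltrDl l0 -EFinD addrC addKr.
Qed.

Lemma box_carleson_square n (y l : R) : (dyad (n + 1) <= l)%R ->
  box n y `<=` carleson_square `[y, (y + l)%R[.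
Proof.
move=> nl w [/andP[h1 h2] /andP[h3 h4]]; split.
- rewrite in_itv/= h3 (lt_le_trans h4)// lerD2l (le_trans _ nl)//.
  by rewrite dyadS mulr_natl mulr2n lerDl.
- exact: lt_le_trans h1.
- rewrite ilength_bnd ?lee_fin ?(le_trans (ltW h2))//.
  exact: lt_le_trans nl.
Qed.

End carleson_box.

(** A square of side [l] meets about [l / d] boxes of side [d]: replacing them
    by the square loses nothing at exponents [s >= 1]. *)
Lemma ratio_powR_le {R : realType} (d l s : R) : 0 < d -> d <= l -> 1 <= s ->
  l / d * d `^ s <= l `^ s.
Proof.
move=> d0 dl s1; have l0 := lt_le_trans d0 dl.
have s0 : 0 < s by rewrite (lt_le_trans _ s1).
rewrite -(mulr_powRB1 (ltW d0) s0) mulrA divfK ?gt_eqF//.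
rewrite -(mulr_powRB1 (ltW l0) s0) ler_pM2l//.
by rewrite ge0_ler_powR ?subr_ge0// nnegrE ltW.
Qed.

Section carleson_dyadic.
Context {R : realType}.
Variables (q : R) (hq : 2 <= q) (mu : {measure set (R * R) -> \bar R}).
Local Open Scope ereal_scope.

Let q0 : (0 < q)%R. Proof. by rewrite (lt_le_trans _ hq). Qed.

Lemma carleson_strip_le n :
  carleson q (restr_strip mu n) <= 2%:E * box_density mu q n.
Proof.
apply: ge_ereal_sup => _ [J /= /andP[J0 Joo] <-].
have Jfin : ilength J \is a fin_num by rewrite ge0_fin_numE// ltW.
have Jl := fineK Jfin; set l := fine _ in Jl.
have l0 : (0 < l)%R by rewrite -lte_fin Jl.
rewrite -Jl poweR_EFin inver gt_eqF ?powR_gt0//.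
rewrite lee_pdivrMr ?powR_gt0//.
apply: le_trans (carleson_square_strip_le mu n (esym Jl) l0) _.
case: ifPn => [nl|_]; last first.
  by rewrite mule_ge0 ?lee_fin ?powR_ge0// mule_ge0// box_density_ge0.
rewrite (box_massE mu q) [leRHS]muleC [leLHS]muleA [leRHS]muleA; apply: lee_wpmul2r.
  exact: box_density_ge0.
rewrite -!EFinM lee_fin -!mulrA [leRHS]mulrC ler_pM2l// mulrA.
by apply: ratio_powR_le => //; rewrite (le_trans _ hq)// ler1n.
Qed.

Lemma square_le_carleson (nu : set (R * R) -> \bar R) (J : interval R) (l : R) :
  ilength J = l%:E -> (0 < l)%R ->
  nu (carleson_square J) <= (l `^ q)%:E * carleson q nu.
Proof.
move=> Jl l0; rewrite muleC -lee_pdivrMr ?powR_gt0//.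
apply: ereal_sup_ubound; exists J => /=; first by rewrite Jl lte_fin l0 ltry.
by rewrite Jl poweR_EFin inver gt_eqF ?powR_gt0.
Qed.

Lemma square_le_carleson_at (nu : set (R * R) -> \bar R) (J : interval R) (l : R) :
  ilength J = l%:E -> (0 < l)%R ->
  nu (carleson_square J) <= (l `^ q)%:E * carleson_at q nu l.
Proof.
move=> Jl l0; rewrite muleC -lee_pdivrMr ?powR_gt0//.
by apply: ereal_sup_ubound; exists J => //=; rewrite inver gt_eqF ?powR_gt0.
Qed.

Lemma carleson_ge0 (nu : set (R * R) -> \bar R) :
  (forall A, 0 <= nu A) -> 0 <= carleson q nu.
Proof.
move=> nu0; have := square_le_carleson nu (ilength_bnd 0 ltr01) ltr01.
by rewrite powR1 mul1e; exact: le_trans.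
Qed.

Lemma carleson_at_ge0 (nu : set (R * R) -> \bar R) t : (0 < t)%R ->
  (forall A, 0 <= nu A) -> 0 <= carleson_at q nu t.
Proof.
move=> t0 nu0; have := square_le_carleson_at nu (ilength_bnd 0 t0) t0.
by move/(le_trans (nu0 _)); rewrite pmule_rge0// lte_fin powR_gt0.
Qed.

Lemma carleson_strip_ge n :
  box_density mu q n <= (2 `^ q)%:E * carleson q (restr_strip mu n).
Proof.
have C0 : 0 <= carleson q (restr_strip mu n) by apply: carleson_ge0 => A; exact: measure_ge0.
suff h y : mu (box n y) <= (dyad (n + 1) `^ q)%:E * carleson q (restr_strip mu n).
  rewrite /box_density powRN.
  rewrite lee_pdivrMl ?powR_gt0// muleA -EFinM -powRM// mulrC -dyadS.
  by apply: ge_ereal_sup => _ [y _ <-]; exact: h.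
apply: le_trans (square_le_carleson _ (ilength_bnd y (dyad_gt0 (n + 1))) (dyad_gt0 _)).
apply: le_measure; rewrite ?inE; first exact: measurable_box.
  apply: measurableI; last exact: measurable_strip.
  by apply: measurable_carleson_square; rewrite ilength_bnd// lte_fin dyad_gt0 ltry.
move=> w nw; split; first exact: box_carleson_square nw.
by case: nw.
Qed.

(** A square of side [t] meets all the strips with index at most [m]; the
    weight [2 ^ ((m - n) (1 - q))] is summable since [q > 1]. *)
Lemma carleson_at_le m t : (dyad m <= t < dyad (m + 1))%R ->
  carleson_at q mu t <= \esum_(n in [set: int])
    (2%:E * ((if (0 <= m - n)%R then dyad (m - n) `^ (1 - q) else 0)%:E
       * box_density mu q n)).
Proof.
move=> /andP[mt tm]; have t0 : (0 < t)%R by exact: lt_le_trans mt.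
apply: ge_ereal_sup => _ [J /= Jt <-].
rewrite inver gt_eqF ?powR_gt0// lee_pdivrMr ?powR_gt0//.
apply: le_trans (carleson_square_sum_le mu Jt t0) _.
have k0 n : 0 <= 2%:E * ((if (0 <= m - n)%R then dyad (m - n) `^ (1 - q) else 0)%:E
    * box_density mu q n).
  rewrite mule_ge0// mule_ge0// ?box_density_ge0// lee_fin.
  by case: ifP => // _; exact: powR_ge0.
have t0' : 0 <= (t `^ q)%:E by rewrite lee_fin powR_ge0.
rewrite [leRHS]muleC; apply: le_trans _ (esumZl_le t0' k0).
apply: le_esum => n _.
case: ifPn => [nt|_]; last first.
  by rewrite mule_ge0.
have nm : (n <= m)%R.
  by rewrite -ltzD1; apply: dyad_lt_inv; exact: le_lt_trans tm.
rewrite subr_ge0 nm (box_massE mu q) [leLHS]muleA [leRHS]muleA [leRHS]muleA; apply: lee_wpmul2r.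
  exact: box_density_ge0.
rewrite -!EFinM lee_fin powR_dyadB !powRB ?dyad_neq0 ?implybT// !powRr1//.
have h := ratio_powR_le (dyad_gt0 m) mt (le_trans (ler1n _ 2) hq).
have a0 : (dyad m `^ q != 0)%R by rewrite gt_eqF ?powR_gt0.
have b0 : (dyad n `^ q != 0)%R by rewrite gt_eqF ?powR_gt0.
have -> : (2 * t / dyad n * dyad n `^ q =
   t / dyad m * dyad m `^ q *
   (2 * (dyad m / dyad m `^ q / (dyad n / dyad n `^ q))))%R.
  by field; rewrite a0 b0 !dyad_neq0.
rewrite -[leRHS]mulrA ler_wpM2r//.
by rewrite mulr_ge0// !divr_ge0// powR_ge0.
Qed.

(** A box of the strip [m - 1] fits into a square of side [t]. *)
Lemma carleson_at_ge m t : (dyad m <= t < dyad (m + 1))%R ->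
  box_density mu q (m - 1)%R <= (4 `^ q)%:E * carleson_at q mu t.
Proof.
move=> /andP[mt tm]; have t0 : (0 < t)%R by exact: lt_le_trans mt.
have C0 : 0 <= carleson_at q mu t by apply: carleson_at_ge0.
suff h y : mu (box (m - 1) y) <= (t `^ q)%:E * carleson_at q mu t.
  rewrite /box_density powRN.
  rewrite lee_pdivrMl ?powR_gt0// muleA -EFinM.
  apply: ge_ereal_sup => _ [y _ <-]; apply: le_trans (h y) _.
  apply: lee_wpmul2r => //; rewrite lee_fin -powRM//.
  rewrite ge0_ler_powR ?nnegrE ?mulr_ge0//; try exact: ltW.
  rewrite (le_trans (ltW tm))// -{1}(subrK 1%R m) !dyadS mulrA.
  by rewrite (_ : 4 = 2 * 2)%R 1?mulrC// -natrM.
apply: le_trans (square_le_carleson_at _ (ilength_bnd y t0) t0).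
apply: le_measure; rewrite ?inE; first exact: measurable_box.
  by apply: measurable_carleson_square; rewrite ilength_bnd// lte_fin t0 ltry.
by apply: box_carleson_square; rewrite subrK.
Qed.

End carleson_dyadic.
(** * Sums over the integers and integrals over dyadic intervals *)

Section integer_sums.
Context {R : realType}.

(** Each absolute value is taken by at most two integers. *)
Lemma sum_int_le (f : nat -> R) (B : R) (s : seq int) : uniq s ->
  (forall n, 0 <= f n) -> (forall N, \sum_(0 <= j < N) f j <= B) ->
  \sum_(i <- s) f `|i|%N <= 2 * B.
Proof.
move=> us f0 fB.
have [N hN] : exists N : nat, forall i, i \in s -> (`|i| < N)%N.
  by exists (\max_(i <- s) `|i|%N).+1 => i si; rewrite ltnS; exact: leq_bigmax_seq.
pose r := [seq Posz j | j <- iota 0 N] ++ [seq Negz j | j <- iota 0 N].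
have ur : uniq r.
  rewrite cat_uniq !map_inj_uniq ?iota_uniq/= ?andbT; try by move=> ? ? [].
  by apply/hasPn => _ /mapP[j _ ->]; apply/negP => /mapP[].
have sr : {subset s <= r}.
  move=> i /hN.
  rewrite mem_cat; case: i => j /= jN; apply/orP; [left|right].
    by rewrite map_f// mem_iota.
  by rewrite map_f// mem_iota/= ltnW.
apply: (@le_trans _ _ (\sum_(i <- r) f `|i|%N)).
  rewrite [leRHS](bigID (mem s))/= -[X in _ <= X + _]big_filter.
  rewrite (perm_big [seq i <- r | i \in s]) ?lerDl ?sumr_ge0//.
  by apply: uniq_perm; rewrite ?filter_uniq// => i; rewrite mem_filter andb_idr//; exact: sr.
rewrite big_cat/= !big_map mulr_natl mulr2n lerD//.
  by have := fB N; rewrite /index_iota subn0.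
apply: le_trans (fB N.+1); rewrite big_nat_recl// -[leLHS]add0r lerD//.
by rewrite /index_iota subn0.
Qed.

Lemma esum_geometric_int (s : R) : 0 < s ->
  (\esum_(n in [set: int]) ((dyad `|n|%N) `^ (- s))%:E < +oo)%E.
Proof.
move=> s0; pose r : R := 2 `^ (- s).
have r0 : 0 < r by rewrite powR_gt0.
have r1 : r < 1.
  rewrite /r -[ltRHS](powRr0 2) /powR pnatr_eq0/= ltr_expR mul0r.
  by rewrite nmulr_rlt0 ?oppr_lt0// ln_gt0// ltr1n.
apply: (@le_lt_trans _ _ (2 * (1 - r)^-1)%:E); last exact: ltry.
apply: esum_le_seq => l ul.
rewrite sumEFin lee_fin.
under eq_bigr do rewrite dyad_powR powRAC -pmulrn powR_mulrn ?powR_ge0//.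
apply: (@sum_int_le (fun n => r ^+ n)) => // [n|N]; first by rewrite exprn_ge0// ltW.
rewrite big_mkord -[leRHS]mul1r ler_pdivlMr ?subr_gt0//.
by rewrite mulrC -opprB mulNr -subrX1 opprB lerBlDr lerDl exprn_ge0// ltW.
Qed.

(** The bound is uniform in [u]: distances to [u] are compared with distances
    to its integer part. *)
Lemma sum_inv_sqr_int (A u : R) (s : seq int) : 1 <= A -> uniq s ->
  \sum_(k <- s) ((A + `|k%:~R - u|) ^+ 2)^-1 <= 16 / A.
Proof.
move=> A1 us; have A0 : 0 < A by rewrite (lt_le_trans _ A1).
pose v := Num.floor u.
have uv : `|u - v%:~R| <= 1.
  have /andP[h1 h2] := floor_itv u.
  by rewrite ger0_norm ?subr_ge0// lerBlDl -intrD1 ltW.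
apply: (@le_trans _ _ (\sum_(k <- s) 4 * ((A + (`|k - v|%N)%:R) ^+ 2)^-1)).
  apply: ler_sum => k _.
  have h : A + `|k - v|%N%:R <= 2 * (A + `|k%:~R - u|).
    have -> : (`|k - v|%N)%:R = `|k%:~R - v%:~R| :> R.
      by rewrite -intrB -intr_norm -abszE.
    have := ler_distD u (k%:~R : R) v%:~R; have := normr_ge0 (k%:~R - u); lra.
  have h0 : 0 < A + `|k - v|%N%:R by rewrite ltr_wpDr.
  have h1 : 0 < A + `|k%:~R - u| by rewrite ltr_wpDr.
  rewrite ler_pdivlMr ?exprn_gt0// ler_pdivrMl ?exprn_gt0//.
  have : (A + `|k - v|%N%:R) ^+ 2 <= (2 * (A + `|k%:~R - u|)) ^+ 2.
    by rewrite ler_sqr ?nnegrE ?mulr_ge0// ltW.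
  by rewrite exprMn; lra.
rewrite -mulr_sumr.
have -> : \sum_(k <- s) ((A + `|k - v|%N%:R) ^+ 2)^-1 =
   \sum_(k <- [seq (k - v)%R | k <- s]) ((A + `|k|%N%:R) ^+ 2)^-1.
  by rewrite big_map.
have := @sum_int_le (fun n => ((A + n%:R) ^+ 2)^-1) (2 / A) [seq (k - v)%R | k <- s].
rewrite map_inj_uniq; last exact: addIr.
move=> /(_ us) h; have {}h : \sum_(k <- [seq (k - v)%R | k <- s]) ((A + `|k|%N%:R) ^+ 2)^-1 <= 2 * (2 / A).
  apply: h => [n|N]; first by rewrite invr_ge0 sqr_ge0.
  (* The sum is dominated by a telescoping one. *)
  apply: (@le_trans _ _ (2 / A - 2 / (A + N%:R))).
    elim: N => [|N IH]; first by rewrite big_nil addr0 subrr.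
    rewrite big_nat_recr//= -[N.+1%:R]natr1.
    have x0 : 0 < A + N%:R by rewrite ltr_wpDr.
    have x1 : 1 <= A + N%:R by rewrite (le_trans A1)// lerDl.
    rewrite addrA; move: (A + N%:R) x0 x1 IH => x x0 x1 IH.
    have hx : (x ^+ 2)^-1 <= 2 / x - 2 / (x + 1).
      have -> : 2 / x - 2 / (x + 1) = 2 / (x * (x + 1)).
        by field; rewrite !gt_eqF// ltr_wpDr.
      rewrite ler_pdivlMr ?mulr_gt0 ?addr_gt0// ler_pdivrMl ?exprn_gt0//.
      by nra.
    lra.
  by rewrite lerBlDr lerDl divr_ge0// addr_ge0// ltW.
lra.
Qed.

End integer_sums.

Section dyadic_integral.
Context {R : realType}.
Variables (F : R -> \bar R) (a : int -> \bar R).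
Context (F0 : forall t : R, 0 < t -> (0 <= F t)%E) (a0 : forall n, (0 <= a n)%E).
Local Open Scope ereal_scope.

Let ditv (m : int) : set R := `[dyad m, dyad (m + 1)[%classic.

Let mu_ditv m : lebesgue_measure (ditv m) = (dyad m)%:E :> \bar R.
Proof.
rewrite /ditv lebesgue_measure_itv/= lte_fin lt_dyad ?ltrDl// -EFinD.
by rewrite dyadS mulr_natl mulr2n addrK.
Qed.

Let posrealsP (t : R) : posreals t <-> (0 < t)%R.
Proof. by rewrite /posreals/= in_itv/= andbT. Qed.

(** If [F] is bounded on each dyadic interval, whose length is [2 ^ m], by
    [2 ^ (- m)] times a convolution, then its integral is bounded by the
    product of the two sums. *)
Lemma dyadic_integral_le (k : int -> \bar R) : (forall n, 0 <= k n) ->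
  (forall m t, (dyad m <= t < dyad (m + 1))%R ->
    F t <= ((dyad m)^-1)%:E * (\esum_(n in [set: int]) (k (m - n)%R * a n))) ->
  \int[lebesgue_measure]_(t in posreals) F t <=
  (\esum_(n in [set: int]) k n) * (\esum_(n in [set: int]) a n).
Proof.
move=> k0 Fk; apply: le_trans (esum_conv_le k0 a0).
apply: le_trans (@integral_le_cover _ _ _ lebesgue_measure _ _ ditv _
  (fun m => ((dyad m)^-1)%:E * (\esum_(n in [set: int]) (k (m - n)%R * a n)))
  _ _ _ _ _) _.
- by move=> m; exact: measurable_itv.
- move=> t /posrealsP /dyad_ex[m mt]; exists m.
  by rewrite /ditv /= in_itv.
- by move=> t /posrealsP/F0.
- move=> m; rewrite mule_ge0// ?lee_fin ?invr_ge0//; apply: esum_ge0 => n _.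
  by rewrite mule_ge0.
- by move=> m t _; rewrite /ditv/= in_itv/=; exact: Fk.
- apply: le_esum => m _; rewrite [X in _ * X <= _](mu_ditv m) muleAC -EFinM mulVf// ?mul1e//.
Qed.

Lemma dyadic_integral_ge (j : int) :
  (forall m t, (dyad m <= t < dyad (m + 1))%R ->
    ((dyad m)^-1)%:E * a (m + j)%R <= F t) ->
  (\esum_(n in [set: int]) a n) <= \int[lebesgue_measure]_(t in posreals) F t.
Proof.
move=> Fa; rewrite -(esum_shift a j).
apply: le_trans (@packing_le_integral _ _ _ lebesgue_measure _ _ ditv _
  (fun m => ((dyad m)^-1)%:E * a (m + j)%R) _ _ _ _ _ _).
- by apply: le_esum => m _; rewrite [X in _ <= _ * X](mu_ditv m) muleAC -EFinM mulVf// mul1e.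
- by move=> m; exact: measurable_itv.
- move=> m t; rewrite /ditv/= in_itv/= => /andP[mt _].
  by apply/posrealsP; exact: lt_le_trans mt.
- by move=> m n t; rewrite /ditv/= !in_itv/=; exact: dyad_uniq.
- by move=> t /posrealsP/F0.
- by move=> m; rewrite mule_ge0// lee_fin invr_ge0.
- by move=> m t; rewrite /ditv/= in_itv/=; exact: Fa.
Qed.

End dyadic_integral.

Section comparable.
Context {R : realType}.
Local Open Scope ereal_scope.

(** Two functionals of a measure are equivalent when each is bounded by a
    constant multiple of the other. *)
Definition equivalent (F G : {measure set (R * R) -> \bar R} -> \bar R) : Prop :=
  exists A B : R, [/\ (0 < A)%R, (0 < B)%R &
    forall mu, F mu <= A%:E * G mu /\ G mu <= B%:E * F mu].

Lemma equivalent_sym F G : equivalent F G -> equivalent G F.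
Proof. by move=> [A [B [A0 B0 h]]]; exists B, A; split => // mu; have [] := h mu. Qed.

Lemma equivalent_trans F G H : equivalent F G -> equivalent G H -> equivalent F H.
Proof.
move=> [A [B [A0 B0 h]]] [A' [B' [A'0 B'0 h']]]; exists (A * A')%R, (B' * B)%R.
split; rewrite ?mulr_gt0// => mu; have [h1 h2] := h mu; have [h3 h4] := h' mu.
rewrite !EFinM -!muleA; split.
  by apply: le_trans h1 _; apply: lee_wpmul2l => //; rewrite lee_fin ltW.
by apply: le_trans h4 _; apply: lee_wpmul2l => //; rewrite lee_fin ltW.
Qed.

Lemma equivalent_fin F G mu : equivalent F G -> F mu < +oo -> G mu < +oo.
Proof.
move=> [A [B [A0 B0 h]]] Foo; have [_ h2] := h mu.
by apply: le_lt_trans h2 _; rewrite lte_mul_pinfty// lee_fin ltW.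
Qed.

Lemma equivalent_comparable F G : equivalent F G ->
  exists c C : R, [/\ (0 < c)%R, (0 < C)%R & forall mu, comparable_with c C (F mu) (G mu)].
Proof.
move=> [A [B [A0 B0 h]]]; exists A^-1%R, B; split; rewrite ?invr_gt0// => mu.
by have [h1 h2] := h mu; split => //; rewrite lee_pdivrMl.
Qed.

End comparable.

Section carleson_equivalent.
Context {R : realType}.
Variables (q : R) (hq : 2 <= q).
Local Open Scope ereal_scope.

Lemma carleson_sum_equivalent : equivalent (@carleson_sum R q) (fun mu => dyadic_sum mu q).
Proof.
exists 2%R, (2 `^ q)%R; split; rewrite ?powR_gt0// => mu; split.
  apply: le_trans (esumZl_le _ _); last by move=> n; exact: box_density_ge0.
    by apply: le_esum => n _; exact: carleson_strip_le.
  by [].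
apply: le_trans (esumZl_le _ _).
- by apply: le_esum => n _; exact: carleson_strip_ge.
- by rewrite lee_fin powR_ge0.
- by move=> n; apply: carleson_ge0 => // A; exact: measure_ge0.
Qed.

Lemma carleson_integral_equivalent :
  equivalent (@carleson_integral R q) (fun mu => dyadic_sum mu q).
Proof.
have q1 : (0 < q - 1)%R by rewrite subr_gt0 (lt_le_trans _ hq)// ltr1n.
have q0 : (0 < q)%R by rewrite (lt_le_trans _ hq).
pose k (n : int) : \bar R := 2%:E * ((dyad `|n|%N) `^ (- (q - 1)))%:E.
have k0 n : 0 <= k n by rewrite mule_ge0// lee_fin powR_ge0.
have Koo : \esum_(n in [set: int]) k n < +oo.
  apply: (@le_lt_trans _ _ (2%:E * (\esum_(n in [set: int]) ((dyad `|n|%N) `^ (- (q - 1)))%:E))).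
    by apply: esumZl_le => // n; rewrite lee_fin powR_ge0.
  by rewrite lte_mul_pinfty//; exact: esum_geometric_int.
have K0 : 0 <= \esum_(n in [set: int]) k n by exact: esum_ge0.
have Kfin : \esum_(n in [set: int]) k n \is a fin_num by rewrite ge0_fin_numE.
(* Adding [1] makes the constant positive. *)
exists (fine (\esum_(n in [set: int]) k n) + 1)%R, (2 * 4 `^ q)%R.
split; rewrite ?mulr_gt0 ?powR_gt0//.
  by rewrite ltr_wpDl// fine_ge0.
move=> mu.
have C0 t : (0 < t)%R -> 0 <= (t^-1)%:E * carleson_at q mu t.
  by move=> t0; apply: mule_ge0; [rewrite lee_fin invr_ge0 ltW|exact: carleson_at_ge0].
split.
  apply: (@le_trans _ _ ((\esum_(n in [set: int]) k n) * dyadic_sum mu q)); last first.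
    apply: lee_wpmul2r; first exact: dyadic_sum_ge0.
    by rewrite -[leLHS]fineK// lee_fin lerDl.
  apply: dyadic_integral_le => // [n|m t mt]; first exact: box_density_ge0.
  have t0 : (0 < t)%R by case/andP : mt => mt _; exact: lt_le_trans mt.
  apply: lee_pmul.
  - by rewrite lee_fin invr_ge0 ltW.
  - exact: carleson_at_ge0.
  - by rewrite lee_fin lef_pV2// ?posrE//; case/andP : mt.
  - apply: le_trans (carleson_at_le hq mu mt) _; apply: le_esum => n _.
    rewrite /k -muleA; apply: lee_wpmul2l => //.
    apply: lee_wpmul2r; first exact: box_density_ge0.
    rewrite lee_fin; case: ifPn => [mn|_]; last exact: powR_ge0.
    by rewrite gez0_abs// opprB.
rewrite -lee_pdivrMl ?mulr_gt0 ?powR_gt0//.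
rewrite [leLHS](_ : _ = ((2 * 4 `^ q)^-1)%:E * \esum_(n in [set: int]) box_density mu q n)//.
apply: le_trans (esumZl_ge _ _) _.
- by rewrite invr_gt0 mulr_gt0 ?powR_gt0.
- by move=> n; exact: box_density_ge0.
apply: (@dyadic_integral_ge _ _ _ _ _ (-1)%R) => // [n|m t mt].
  by rewrite mule_ge0 ?lee_fin ?invr_ge0 ?mulr_ge0 ?powR_ge0// box_density_ge0.
have t0 : (0 < t)%R by case/andP : mt => mt _; exact: lt_le_trans mt.
rewrite muleA -EFinM -invfM.
rewrite lee_pdivlMl// muleA.
have h := carleson_at_ge hq mu mt.
apply: (@le_trans _ _ ((t / (dyad m * (2 * 4 `^ q)))%:E * ((4 `^ q)%:E * carleson_at q mu t))).
  rewrite -EFinM; apply: lee_wpmul2l => //.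
  by rewrite lee_fin divr_ge0 ?mulr_ge0 ?powR_ge0// ltW.
rewrite muleA -EFinM -[leRHS]mul1e; apply: lee_wpmul2r.
  exact: carleson_at_ge0.
rewrite lee_fin.
have -> : (t / (dyad m * (2 * 4 `^ q)) * 4 `^ q = t / (2 * dyad m))%R.
  by field; rewrite dyad_neq0 gt_eqF ?powR_gt0.
rewrite ler_pdivrMr ?mulr_gt0// mul1r -dyadS.
by case/andP : mt => _ /ltW.
Qed.

End carleson_equivalent.
(** * The Berezin-type conditions *)

Section berezin_kernel.
Context {R : realType}.
Variables (a b : R).

Local Notation c := (a + b + 2).

(** The common form of the two Berezin kernels: homogeneous of degree [-2]. *)
Definition bkernel (z w : R * R) : R :=
  z.1 `^ a / Normc.normc (toC w + (toC z)^*%C) `^ c * w.1 `^ b.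

Lemma normc_toC (z w : R * R) :
  Normc.normc (toC w + (toC z)^*%C) = Num.sqrt ((w.1 + z.1) ^+ 2 + (w.2 - z.2) ^+ 2).
Proof. by rewrite /toC /=. Qed.

Lemma normc_toC_le (z w : R * R) : 0 <= z.1 -> 0 <= w.1 ->
  Normc.normc (toC w + (toC z)^*%C) <= w.1 + z.1 + `|w.2 - z.2|.
Proof.
move=> z0 w0; rewrite normc_toC.
rewrite -[leRHS]ger0_norm; last by rewrite !addr_ge0.
rewrite -sqrtr_sqr ler_wsqrtr// -[X in _ + X <= _]real_normK ?num_real//.
have := normr_ge0 (w.2 - z.2); nra.
Qed.

Lemma normc_toC_ge (z w : R * R) : 0 <= z.1 -> 0 <= w.1 ->
  (w.1 + z.1 + `|w.2 - z.2|) / 2 <= Normc.normc (toC w + (toC z)^*%C).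
Proof.
move=> z0 w0; rewrite normc_toC.
rewrite -[leLHS]ger0_norm; last by rewrite divr_ge0// !addr_ge0.
rewrite -sqrtr_sqr ler_wsqrtr// -[X in _ <= _ + X]real_normK ?num_real//.
move: (w.1 + z.1) `|w.2 - z.2| => p d.
have := sqr_ge0 (p - d); have := sqr_ge0 p; have := sqr_ge0 d; lra.
Qed.

(** On a dyadic interval a power varies by a bounded factor. *)
Lemma powR_dyad_bounds n (x s : R) : dyad n <= x <= 2 * dyad n ->
  2 `^ (- `|s|) * dyad n `^ s <= x `^ s <= 2 `^ `|s| * dyad n `^ s.
Proof.
move=> /andP[nx xn]; have x0 : 0 < x by exact: lt_le_trans nx.
pose r := x / dyad n.
have r1 : 1 <= r by rewrite /r ler_pdivlMr// mul1r.
have r2 : r <= 2 by rewrite /r ler_pdivrMr// mulrC.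
have r0 : 0 < r by exact: lt_le_trans r1.
have -> : x = r * dyad n by rewrite /r divfK.
rewrite powRM ?(ltW r0)// !ler_pM2r ?powR_gt0//.
have h1 : r `^ `|s| <= 2 `^ `|s| by rewrite ge0_ler_powR// nnegrE ltW.
apply/andP; split.
  apply: (@le_trans _ _ (r `^ (- `|s|))).
    by rewrite !powRN lef_pV2// posrE powR_gt0.
  by rewrite ler_powR// lerNl -normrN ler_norm.
by apply: le_trans h1; rewrite ler_powR// ler_norm.
Qed.

Lemma bkernel_ge0 z w : 0 <= bkernel z w.
Proof. by rewrite /bkernel mulr_ge0 ?divr_ge0// powR_ge0. Qed.

Context (c0 : 2 <= c).

Let c_ge0 : 0 <= c. Proof. exact: le_trans c0. Qed.

(** On the box at the scale and the height of [z] the kernel is at least a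
    multiple of [2 ^ (- 2 m)]. *)
Lemma bkernel_ge (m : int) (z w : R * R) :
  dyad m <= z.1 < dyad (m + 1) -> box m z.2 w ->
  2 `^ (- `|a|) * 2 `^ (- `|b|) / 5 `^ c * (dyad m ^+ 2)^-1 <= bkernel z w.
Proof.
move=> /andP[z1 z2] [/andP[w1 w2] /andP[w3 w4]].
have z0 : 0 < z.1 by exact: lt_le_trans z1.
have w0 : 0 < w.1 by exact: lt_le_trans w1.
move: z2 w2; rewrite dyadS => z2 w2.
have /andP[ha _] : 2 `^ (- `|a|) * dyad m `^ a <= z.1 `^ a <= 2 `^ `|a| * dyad m `^ a.
  by apply: powR_dyad_bounds; rewrite z1 ltW.
have /andP[hb _] : 2 `^ (- `|b|) * dyad m `^ b <= w.1 `^ b <= 2 `^ `|b| * dyad m `^ b.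
  by apply: powR_dyad_bounds; rewrite w1 ltW.
have hN : Normc.normc (toC w + (toC z)^*%C) <= 5 * dyad m.
  apply: le_trans (normc_toC_le (ltW z0) (ltW w0)) _.
  by rewrite ger0_norm ?subr_ge0//; lra.
have hN0 : 0 < Normc.normc (toC w + (toC z)^*%C).
  apply: lt_le_trans (normc_toC_ge (ltW z0) (ltW w0)).
  by rewrite divr_gt0// ltr_pwDl// addr_gt0.
have hc : (5 * dyad m) `^ (- c) <= Normc.normc (toC w + (toC z)^*%C) `^ (- c).
  rewrite !powRN lef_pV2 ?posrE ?powR_gt0// ?mulr_gt0//.
  by rewrite ge0_ler_powR ?nnegrE ?mulr_ge0 ?(ltW hN0).
rewrite /bkernel -(powRN (Normc.normc _)).
apply: (@le_trans _ _ ((2 `^ (- `|a|) * dyad m `^ a) * (5 * dyad m) `^ (- c) *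
   (2 `^ (- `|b|) * dyad m `^ b))).
  rewrite powRM// (powRN 5).
  have -> : (dyad m ^+ 2)^-1 = dyad m `^ a * dyad m `^ (- c) * dyad m `^ b.
    rewrite -!powRD ?dyad_neq0 ?implybT//.
    by rewrite (_ : a - c + b = - 2%:R); [rewrite powRN powR_mulrn|ring].
  lra.
by apply: ler_pM => //; rewrite ?ler_pM ?mulr_ge0 ?powR_ge0.
Qed.

(** On the box of index [(n, k)] the modulus in the denominator is at least a
    multiple of [2 ^ n] times the sum of [A] and the normalized vertical
    distance; two of the [c] powers are kept for the summation over [k]. *)
Lemma bkernel_le (m n k : int) (z w : R * R) (A : R) : A = 1 + dyad (m - n) ->
  dyad m <= z.1 < dyad (m + 1) -> box n (k%:~R * dyad n) w ->
  bkernel z w <=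
    2 `^ `|a| * 2 `^ `|b| * 4 `^ c * (dyad (m - n) `^ a * (dyad n ^+ 2)^-1) *
    A `^ (2 - c) * ((A + `|k%:~R - z.2 / dyad n|) ^+ 2)^-1.
Proof.
move=> AE /andP[z1 z2] [/andP[w1 w2] /andP[w3 w4]].
have z0 : 0 < z.1 by exact: lt_le_trans z1.
have w0 : 0 < w.1 by exact: lt_le_trans w1.
move: z2 w2; rewrite !dyadS => z2 w2.
have /andP[_ ha] : 2 `^ (- `|a|) * dyad m `^ a <= z.1 `^ a <= 2 `^ `|a| * dyad m `^ a.
  by apply: powR_dyad_bounds; rewrite z1 ltW.
have /andP[_ hb] : 2 `^ (- `|b|) * dyad n `^ b <= w.1 `^ b <= 2 `^ `|b| * dyad n `^ b.
  by apply: powR_dyad_bounds; rewrite w1 ltW.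
set X := A + `|k%:~R - z.2 / dyad n|.
have A1 : 1 <= A by rewrite AE lerDl.
have AX : A <= X by rewrite lerDl.
have X0 : 0 < X by rewrite (lt_le_trans ltr01)// (le_trans A1).
have hN : dyad n * X / 4 <= Normc.normc (toC w + (toC z)^*%C).
  apply: le_trans (normc_toC_ge (ltW z0) (ltW w0)).
  have -> : dyad n * X = dyad n + dyad m + `|k%:~R * dyad n - z.2|.
    rewrite /X AE dyadB !mulrDr mulr1 mulrCA divff// mulr1; congr (_ + _).
    by rewrite -{1}(gtr0_norm (dyad_gt0 n)) -normrM mulrBr mulrCA divff// mulr1 mulrC.
  have hk : `|k%:~R * dyad n - w.2| <= dyad n by rewrite ler_norml; lra.
  have := ler_distD w.2 (k%:~R * dyad n) z.2; have := normr_ge0 (w.2 - z.2); have := dyad_ge0 m (R:=R); lra.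
have hc : Normc.normc (toC w + (toC z)^*%C) `^ (- c) <= (dyad n * X / 4) `^ (- c).
  rewrite !powRN lef_pV2 ?posrE ?powR_gt0 ?divr_gt0 ?mulr_gt0//; last first.
    by apply: lt_le_trans hN; rewrite divr_gt0// mulr_gt0.
  rewrite ge0_ler_powR ?nnegrE ?divr_ge0 ?mulr_ge0 ?(ltW X0)//.
  by apply: le_trans hN; rewrite divr_ge0// mulr_ge0// ltW.
rewrite /bkernel -(powRN (Normc.normc _)).
apply: (@le_trans _ _ ((2 `^ `|a| * dyad m `^ a) * (dyad n * X / 4) `^ (- c) *
   (2 `^ `|b| * dyad n `^ b))).
  by apply: ler_pM => //; rewrite ?ler_pM ?mulr_ge0 ?powR_ge0.
have hX : X `^ (- c) <= A `^ (2 - c) * (X ^+ 2)^-1.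
  have -> : X `^ (- c) = X `^ (2 - c) * (X ^+ 2)^-1.
    rewrite -powR_mulrn ?(ltW X0)// -powRB ?(gt_eqF X0) ?implybT//.
    by congr (_ `^ _); ring.
  rewrite ler_pM2r ?invr_gt0 ?exprn_gt0// -(opprB c 2) !powRN.
  rewrite lef_pV2 ?posrE ?powR_gt0//; last exact: lt_le_trans A1.
  by rewrite ge0_ler_powR ?nnegrE ?subr_ge0// ?(ltW X0)// (le_trans ler01).
have e1 : (dyad n * X / 4) `^ (- c) = dyad n `^ (- c) * X `^ (- c) * 4 `^ c.
  rewrite powRM ?mulr_ge0 ?(ltW X0)// powRM ?(ltW X0)//.
  by rewrite -(powR_inv1 (ler0n R 4)) -powRrM mulN1r opprK.
have e2 : dyad (m - n) `^ a * (dyad n ^+ 2)^-1 = dyad m `^ a * dyad n `^ (- c) * dyad n `^ b.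
  rewrite powR_dyadB -!mulrA -powRN; congr (_ * _).
  rewrite -(powR_mulrn _ (dyad_ge0 n)) -powRN -!powRD ?dyad_neq0 ?implybT//.
  by congr (_ `^ _); ring.
rewrite e1 e2.
set P := 2 `^ `|a| * 2 `^ `|b| * 4 `^ c * (dyad m `^ a * dyad n `^ (- c) * dyad n `^ b).
have P0 : 0 <= P by rewrite !mulr_ge0 ?powR_ge0.
rewrite -[leRHS]mulrA; apply: (@le_trans _ _ (P * X `^ (- c))); last exact: ler_wpM2l.
by rewrite le_eqVlt; apply/orP; left; apply/eqP; rewrite /P; ring.
Qed.

End berezin_kernel.

Section berezin_equivalent.
Context {R : realType}.
Variables (q a b : R).
Local Notation c := (a + b + 2).
Context (hq : 2 <= q) (c0 : 2 <= c) (hb : 1 < q + b) (ha : q < a + 2).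
Implicit Type mu : {measure set (R * R) -> \bar R}.

(** The common form of the two Berezin transforms. *)
Definition bintegral mu (z : R * R) : \bar R :=
  (\int[mu]_(w in Cplus) (bkernel a b z w)%:E)%E.

Lemma bintegral_ge0 mu z : (0 <= bintegral mu z)%E.
Proof. by apply: integral_ge0 => w _; rewrite lee_fin bkernel_ge0. Qed.

Let c1 : R := 2 `^ (- `|a|) * 2 `^ (- `|b|) / 5 `^ c.
Let c1_gt0 : 0 < c1.
Proof. by rewrite !mulr_gt0 ?invr_gt0 ?powR_gt0. Qed.

(** Only the box at the scale and the height of [z] is kept. *)
Lemma bintegral_ge mu (m : int) (t : R) : dyad m <= t < dyad (m + 1) ->
  ((c1 * (dyad m ^+ 2)^-1)%:E * box_mass mu m <=
   ereal_sup [set bintegral mu z | z in [set z | z.1 = t]])%E.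
Proof.
move=> mt; have K0 : 0 < c1 * (dyad m ^+ 2)^-1.
  by rewrite mulr_gt0 ?invr_gt0 ?exprn_gt0.
rewrite -lee_pdivlMl//.
apply: ge_ereal_sup => _ [y _ <-]; rewrite lee_pdivlMl//.
apply: (@le_trans _ _ (bintegral mu (t, y))); last first.
  by apply: ereal_sup_ubound; exists (t, y).
apply: cst_measure_le_integral.
- exact: measurable_box.
- exact: box_Cplus.
- by rewrite lee_fin ltW.
- by move=> w _; rewrite lee_fin bkernel_ge0.
- by move=> w wb; rewrite lee_fin; apply: bkernel_ge.
Qed.

Let C1 : R := 2 `^ `|a| * 2 `^ `|b| * 4 `^ c.
Let C1_gt0 : 0 < C1.
Proof. by rewrite !mulr_gt0 ?powR_gt0. Qed.

(** The sum of the kernel bounds over all the boxes, computed along each strip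
    with [sum_inv_sqr_int]. *)
Lemma bintegral_le mu (m : int) (z : R * R) : dyad m <= z.1 < dyad (m + 1) ->
  (bintegral mu z <= \esum_(n in [set: int])
    ((C1 * (dyad (m - n) `^ a * (dyad n ^+ 2)^-1) * (1 + dyad (m - n)) `^ (2 - c)
      * (16 / (1 + dyad (m - n))))%:E * box_mass mu n))%E.
Proof.
move=> mz.
pose A n : R := 1 + dyad (m - n).
have A1 n : 1 <= A n by rewrite lerDl.
pose G n : R := C1 * (dyad (m - n) `^ a * (dyad n ^+ 2)^-1) * A n `^ (2 - c).
have G0 n : 0 <= G n.
  by rewrite !mulr_ge0 ?powR_ge0 ?invr_ge0 ?exprn_ge0// ltW.
pose g (p : int * int) : \bar R :=
  (G p.1 * ((A p.1 + `|p.2%:~R - z.2 / dyad p.1|) ^+ 2)^-1)%:E.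
have g0 p : (0 <= g p)%E by rewrite lee_fin mulr_ge0// invr_ge0 sqr_ge0.
pose Q (p : int * int) : set (R * R) := box p.1 (p.2%:~R * dyad p.1).
apply: (@le_trans _ _ (\esum_(p in [set: int * int]) (g p * mu (Q p)))%E).
  apply: integral_le_cover => //.
  - by move=> p; exact: measurable_box.
  - move=> w w0; have [n nw] := dyad_ex w0.
    by have [k kw] := strip_box nw; exists (n, k).
  - by move=> w _; rewrite lee_fin bkernel_ge0.
  - by move=> [n k] w _ wb; rewrite lee_fin /g /G /=; apply: bkernel_le.
rewrite esum_pair; last by move=> p; rewrite mule_ge0.
apply: le_esum => n _.
apply: (@le_trans _ _ (\esum_(k in [set: int]) (g (n, k) * box_mass mu n))%E).
  by apply: le_esum => k _; apply: lee_wpmul2l => //; exact: box_le_mass.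
apply: le_trans (esumZr_le (box_mass_ge0 _ _) _) _ => //.
apply: lee_wpmul2r; first exact: box_mass_ge0.
apply: esum_le_seq => l ul; rewrite /g /= sumEFin lee_fin -mulr_sumr.
by apply: ler_wpM2l => //; exact: sum_inv_sqr_int.
Qed.

Let s : R := Num.min (a + 2 - q) (q + b - 1).
Let s_gt0 : 0 < s.
Proof. by rewrite lt_min subr_gt0 ha subr_gt0 hb. Qed.

(** Both ends of the range of [q] are used here: [1 < q + b] gives the decay
    for [j >= 0], and [q < a + 2] the decay for [j < 0]. *)
Lemma bkernel_decay (j : int) :
  dyad j `^ (2 + a - q) * (1 + dyad j) `^ (1 - c) <= dyad `|j|%N `^ (- s) :> R.
Proof.
have c1' : 1 - c <= 0 by rewrite subr_le0 (le_trans _ c0)// ler1n.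
have s1 : s <= a + 2 - q by rewrite ge_min lexx.
have s2 : s <= q + b - 1 by rewrite ge_min lexx orbT.
have powN (x y r : R) : 0 < x -> x <= y -> r <= 0 -> y `^ r <= x `^ r.
  move=> x0 xy r0; rewrite -(opprK r) !(powRN _ (- r)).
  have y0 : 0 < y by exact: lt_le_trans xy.
  by rewrite lef_pV2 ?posrE ?powR_gt0// ge0_ler_powR ?oppr_ge0// nnegrE ltW.
have [j0|j0] := leP 0 j.
  rewrite gez0_abs//; have j1 : 1 <= dyad j :> R by rewrite -dyad0 le_dyad.
  apply: (@le_trans _ _ (dyad j `^ (2 + a - q) * dyad j `^ (1 - c))).
    by rewrite ler_pM2l ?powR_gt0//; apply: powN => //; rewrite lerDr.
  rewrite -powRD ?dyad_neq0 ?implybT// ler_powR//; lra.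
have -> : dyad j = (dyad `|j|%N)^-1 :> R.
  by rewrite ltz0_abs// -[in LHS](opprK j) -sub0r dyadB dyad0 mul1r.
have j1 : 1 <= dyad `|j|%N :> R by rewrite -dyad0 le_dyad.
apply: (@le_trans _ _ (dyad `|j|%N `^ (- (2 + a - q)) * 1)).
  apply: ler_pM; rewrite ?powR_ge0//.
    by rewrite -(powR_inv1 (dyad_ge0 _)) -powRrM mulN1r.
  have := powN 1 (1 + (dyad `|j|%N)^-1) _ ltr01 _ c1'; rewrite powR1; apply.
  by rewrite lerDl invr_ge0.
by rewrite mulr1 ler_powR//; lra.
Qed.

Lemma line_sup_equivalent :
  equivalent (fun mu => line_sup_integral q (bintegral mu)) (fun mu => dyadic_sum mu q).
Proof.
pose e : R := 2 `^ `|1 - q|.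
have e0 : 0 < e by rewrite powR_gt0.
pose C2 : R := e * C1 * 16.
have C20 : 0 < C2 by rewrite !mulr_gt0.
pose k (n : int) : \bar R := (C2 * dyad `|n|%N `^ (- s))%:E.
have k0 n : (0 <= k n)%E by rewrite lee_fin mulr_ge0 ?powR_ge0// ltW.
have K0 : (0 <= \esum_(n in [set: int]) k n)%E by exact: esum_ge0.
have Kfin : (\esum_(n in [set: int]) k n)%E \is a fin_num.
  rewrite ge0_fin_numE//.
  apply: (@le_lt_trans _ _ (C2%:E * (\esum_(n in [set: int]) ((dyad `|n|%N) `^ (- s))%:E))%E).
    rewrite /k; under eq_esum do rewrite EFinM.
    apply: esumZl_le => [|n]; first by rewrite lee_fin ltW.
    by rewrite lee_fin powR_ge0.
  by rewrite lte_mul_pinfty// ?lee_fin ?ltW//; exact: esum_geometric_int.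
(* Adding [1] makes the constant positive. *)
exists (fine (\esum_(n in [set: int]) k n)%E + 1), (e / c1).
split; [by rewrite ltr_wpDl// fine_ge0|by rewrite divr_gt0|move=> mu].
have sup0 t : (0 <= ereal_sup [set bintegral mu z | z in [set z | z.1 = t]])%E.
  apply: (le_trans (bintegral_ge0 mu (t, 0))).
  by apply: ereal_sup_ubound; exists (t, 0).
have F0 t : 0 < t -> (0 <= (t `^ (1 - q))%:E *
    ereal_sup [set bintegral mu z | z in [set z | z.1 = t]])%E.
  by move=> t0; rewrite mule_ge0// lee_fin powR_ge0.
have tb m t : dyad m <= t < dyad (m + 1) ->
    e^-1 * dyad m `^ (1 - q) <= t `^ (1 - q) <= e * dyad m `^ (1 - q).
  move=> /andP[mt tm]; rewrite -powRN; apply: powR_dyad_bounds.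
  by rewrite mt -dyadS ltW.
split.
  apply: (@le_trans _ _ ((\esum_(n in [set: int]) k n) * dyadic_sum mu q)%E); last first.
    apply: lee_wpmul2r; first exact: dyadic_sum_ge0.
    by rewrite -[leLHS]fineK// lee_fin lerDl.
  apply: dyadic_integral_le => // [n|m t mt]; first exact: box_density_ge0.
  have /andP[_ tm] := tb _ _ mt.
  apply: (@le_trans _ _ ((e * dyad m `^ (1 - q))%:E *
      ereal_sup [set bintegral mu z | z in [set z | z.1 = t]])%E).
    by apply: lee_wpmul2r => //; rewrite lee_fin.
  have em0 : 0 < e * dyad m `^ (1 - q) by rewrite mulr_gt0// powR_gt0.
  rewrite -lee_pdivlMl//; apply: ge_ereal_sup => _ [z /= zt <-].
  rewrite lee_pdivlMl//.
  apply: (@le_trans _ _ ((e * dyad m `^ (1 - q))%:E * _)%E).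
    apply: lee_wpmul2l; first by rewrite lee_fin ltW.
    by apply: bintegral_le; rewrite zt; exact: mt.
  apply: le_trans (esumZl_ge _ _) _ => //.
    move=> n; rewrite mule_ge0 ?box_mass_ge0// lee_fin.
    by rewrite !mulr_ge0 ?powR_ge0 ?invr_ge0 ?exprn_ge0 ?addr_ge0// ltW.
  have d0 : (0 <= ((dyad m)^-1)%:E :> \bar R)%E by rewrite lee_fin invr_ge0.
  have kd0 n : (0 <= k (m - n)%R * box_density mu q n)%E.
    by rewrite mule_ge0 ?box_density_ge0.
  apply: le_trans _ (esumZl_le d0 kd0).
  apply: le_esum => n _.
  rewrite (box_massE mu q) [leLHS]muleA [X in (X <= _)%E]muleA [leRHS]muleA.
  apply: lee_wpmul2r; first exact: box_density_ge0.
  rewrite /k -!EFinM lee_fin.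
  have A0 : 0 < 1 + dyad (m - n) :> R by rewrite ltr_wpDr.
  have e1 : e * dyad m `^ (1 - q) *
     (C1 * (dyad (m - n) `^ a / dyad n ^+ 2) * (1 + dyad (m - n)) `^ (2 - c) *
      (16 / (1 + dyad (m - n)))) * dyad n `^ q =
     (dyad m)^-1 * (C2 * (dyad (m - n) `^ (2 + a - q) * (1 + dyad (m - n)) `^ (1 - c))).
    have -> : (1 + dyad (m - n)) `^ (1 - c) = (1 + dyad (m - n)) `^ (2 - c) / (1 + dyad (m - n)) :> R.
      rewrite -[X in _ / X](powRr1 (ltW A0)) -powRB ?(gt_eqF A0) ?implybT//.
      by congr (_ `^ _); ring.
    have -> : dyad (m - n) `^ (2 + a - q) = dyad (m - n) `^ a * (dyad m ^+ 2 * dyad m `^ (- q) / (dyad n ^+ 2 / dyad n `^ q)) :> R.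
      rewrite (_ : 2 + a - q = a + (2%:R - q)); last by ring.
      rewrite powRD ?dyad_neq0 ?implybT// (powR_dyadB _ _ (2%:R - q)).
      rewrite powRB ?dyad_neq0 ?implybT// powR_mulrn// powRN.
      by rewrite powRB ?dyad_neq0 ?implybT// powR_mulrn.
    have -> : dyad m `^ (1 - q) = dyad m * dyad m `^ (- q) :> R.
      by rewrite powRD ?dyad_neq0 ?implybT// powRr1.
    have n0 : dyad n `^ q != 0 :> R by rewrite gt_eqF ?powR_gt0.
    by rewrite /C2; field; rewrite !dyad_neq0 n0 gt_eqF.
  rewrite e1 ler_pM2l ?invr_gt0// ler_pM2l//; exact: bkernel_decay.
rewrite -lee_pdivrMl ?divr_gt0//.
rewrite [leLHS](_ : _ = ((e / c1)^-1)%:E * \esum_(n in [set: int]) box_density mu q n)%E//.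
apply: le_trans (esumZl_ge _ _) _.
- by rewrite invr_gt0 divr_gt0.
- by move=> n; exact: box_density_ge0.
apply: (@dyadic_integral_ge _ _ _ _ _ 0) => // [n|m t mt].
  apply: mule_ge0; last exact: box_density_ge0.
  by rewrite lee_fin invr_ge0 ltW// divr_gt0.
have /andP[tm _] := tb _ _ mt.
apply: (@le_trans _ _ ((e^-1 * dyad m `^ (1 - q))%:E *
      ereal_sup [set bintegral mu z | z in [set z | z.1 = t]])%E); last first.
  by apply: lee_wpmul2r => //; rewrite lee_fin.
apply: (@le_trans _ _ ((e^-1 * dyad m `^ (1 - q))%:E *
    ((c1 * (dyad m ^+ 2)^-1)%:E * box_mass mu m))%E); last first.
  apply: lee_wpmul2l; last exact: bintegral_ge.
  by rewrite lee_fin mulr_ge0 ?invr_ge0 ?powR_ge0// ltW.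
rewrite addr0 (box_massE mu q) [leLHS]muleA [leRHS]muleA [leRHS]muleA -!EFinM; apply: lee_wpmul2r.
  exact: box_density_ge0.
rewrite lee_fin le_eqVlt; apply/orP; left; apply/eqP.
have -> : dyad m `^ (1 - q) = dyad m * (dyad m `^ q)^-1 :> R.
  by rewrite powRD ?dyad_neq0 ?implybT// powRr1// powRN.
by field; rewrite !dyad_neq0 !gt_eqF ?powR_gt0.
Qed.

End berezin_equivalent.

Lemma berezin_tilde_equivalent (R : realType) (q alpha : R) :
  2 <= q -> -1 < alpha -> q < 4 + 2 * alpha ->
  equivalent (fun mu => line_sup_integral q (berezin_tilde alpha mu))
    (fun mu => dyadic_sum mu q).
Proof.
move=> hq ha hqa.
rewrite (_ : (fun mu => line_sup_integral q (berezin_tilde alpha mu)) =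
  (fun mu => line_sup_integral q (bintegral (2 + 2 * alpha) 0 mu))).
  by apply: line_sup_equivalent => //; lra.
apply/funext => mu; congr line_sup_integral; apply/funext => z.
apply: eq_integral => w _; rewrite /bkernel powRr0 mulr1.
by rewrite (_ : 2 + 2 * alpha + 0 + 2 = 4 + 2 * alpha)//; ring.
Qed.

Lemma berezin_equivalent (R : realType) (q alpha : R) :
  2 <= q -> -1 < alpha -> q < 4 + alpha ->
  equivalent (fun mu => line_sup_integral q (berezin alpha mu))
    (fun mu => dyadic_sum mu q).
Proof.
move=> hq ha hqa.
rewrite (_ : (fun mu => line_sup_integral q (berezin alpha mu)) =
  (fun mu => line_sup_integral q (bintegral (2 + alpha) alpha mu))).
  by apply: line_sup_equivalent => //; lra.
apply/funext => mu; congr line_sup_integral; apply/funext => z.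
apply: eq_integral => w _; rewrite /bkernel.
by rewrite (_ : 2 + alpha + alpha + 2 = 4 + 2 * alpha)//; ring.
Qed.
(** * The weighted exponential integrals *)

Section real_derive.
Context {R : realType}.
Implicit Types (f g : R -> R) (t p r : R).

Lemma is_derive_addf f g t df dg : is_derive t (1 : R) f df -> is_derive t (1 : R) g dg ->
  is_derive t (1 : R) (fun t => f t + g t) (df + dg).
Proof. exact: is_deriveD. Qed.

Lemma is_derive_mulf f g t df dg : is_derive t (1 : R) f df -> is_derive t (1 : R) g dg ->
  is_derive t (1 : R) (fun t => f t * g t) (f t * dg + g t * df).
Proof. exact: is_deriveM. Qed.

Lemma is_derive_affine p r t : is_derive t (1 : R) (fun t => p * t + r) p.
Proof.
have h : is_derive t (1 : R) (fun t => p * t + r) ((p * 1 + t * 0) + 0).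
  by apply: is_derive_addf.
by apply: is_derive_eq h _; rewrite mulr1 mulr0 !addr0.
Qed.

Lemma is_derive_compf f g t df dg : is_derive (g t) (1 : R) f df ->
  is_derive t (1 : R) g dg -> is_derive t (1 : R) (fun t => f (g t)) (df * dg).
Proof. by move=> hf hg; exact: (@is_derive1_comp _ f g t df dg hf hg). Qed.

End real_derive.

Section weighted_exponential.
Context {R : realType}.
Implicit Types a b l t : R.

(** The function [(t - l) exp (- a t) cos (b t)] on [[l, +oo)]. Its zero at [l]
    makes the integral decay like [1 / b ^ 2] instead of [1 / b]. *)
Definition wexp a b l t : R := (t - l) * expR (- a * t) * cos (b * t).

Let D a b : R := a ^+ 2 + b ^+ 2.

(** A primitive of [wexp] that vanishes at infinity. *)
Definition wexp_prim a b l t : R := expR (- a * t) *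
  ((- a / D a b * (t - l) - (a ^+ 2 - b ^+ 2) / D a b ^+ 2) * cos (b * t) +
   (b / D a b * (t - l) + 2 * a * b / D a b ^+ 2) * sin (b * t)).

Let D_gt0 a b : 0 < a -> 0 < D a b.
Proof. by move=> a0; rewrite ltr_pwDl ?exprn_gt0// sqr_ge0. Qed.

Lemma is_derive_wexp_prim a b l t : 0 < a ->
  is_derive t (1 : R) (wexp_prim a b l) (wexp a b l t).
Proof.
move=> a0; have D0 : a ^+ 2 + b ^+ 2 != 0 by rewrite gt_eqF// D_gt0.
have lin (p : R) s : is_derive s (1 : R) (fun t => p * t) p.
  have -> : (fun t => p * t) = (fun t => p * t + 0) by apply/funext => u; rewrite addr0.
  exact: is_derive_affine.
have aff p r s : is_derive s (1 : R) (fun t => p * (t - l) + r) p.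
  have -> : (fun t => p * (t - l) + r) = (fun t => p * t + (r - p * l)).
    by apply/funext => u; ring.
  exact: is_derive_affine.
have h := is_derive_mulf (is_derive_compf (is_derive_expR (- a * t)) (lin (- a) t))
  (is_derive_addf
    (is_derive_mulf (aff (- a / D a b) (- ((a ^+ 2 - b ^+ 2) / D a b ^+ 2)) t)
      (is_derive_compf (is_derive_cos (b * t)) (lin b t)))
    (is_derive_mulf (aff (b / D a b) (2 * a * b / D a b ^+ 2) t)
      (is_derive_compf (is_derive_sin (b * t)) (lin b t)))).
apply: is_derive_eq h _; rewrite /wexp /D.
by field.
Qed.

Lemma continuous_wexp_prim a b l : 0 < a -> continuous (wexp_prim a b l).
Proof.
move=> a0 t; apply: differentiable_continuous; apply/derivable1_diffP.
by have [] := is_derive_wexp_prim b l t a0.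
Qed.

Lemma continuous_wexp a b l : continuous (wexp a b l).
Proof.
move=> t; rewrite /wexp; apply: cvgM; last first.
  apply: (@continuous_comp _ _ _ (fun t => b * t) cos); last exact: continuous_cos.
  by apply: cvgMr; exact: cvg_id.
apply: cvgM; first by apply: cvgB; [exact: cvg_id|exact: cvg_cst].
apply: (@continuous_comp _ _ _ (fun t => - a * t) expR); last exact: continuous_expR.
by apply: cvgMr; exact: cvg_id.
Qed.

Lemma expRN_mul_le a t : 0 < a -> 0 < t -> expR (- a * t) <= 4 / (a * t) ^+ 2.
Proof.
move=> a0 t0; rewrite mulNr expRN ler_pdivlMr ?exprn_gt0 ?mulr_gt0//.
rewrite ler_pdivrMl ?expR_gt0//.
have h : 1 + a * t / 2 <= expR (a * t / 2) by exact: expR_ge1Dx.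
have -> : expR (a * t) = expR (a * t / 2) ^+ 2.
  by rewrite -expRM_natr; congr expR; field.
have at0 : 0 < a * t by rewrite mulr_gt0.
nra.
Qed.

Lemma wexp_prim_cvg a b l : 0 < a -> wexp_prim a b l t @[t --> +oo] --> 0.
Proof.
move=> a0; have D0 := D_gt0 b a0.
pose p := - a / D a b; pose p' := - ((a ^+ 2 - b ^+ 2) / D a b ^+ 2).
pose r := b / D a b; pose r' := 2 * a * b / D a b ^+ 2.
pose K : R := (`|p| + `|r|) * (1 + `|l|) + (`|p'| + `|r'|).
have K0 : 0 <= K by rewrite addr_ge0 ?mulr_ge0 ?addr_ge0.
have bnd t : 1 <= t -> `|wexp_prim a b l t| <= (4 * K / a ^+ 2) / t.
  move=> t1; have t0 : 0 < t by exact: lt_le_trans t1.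
  have tl : `|t - l| <= t * (1 + `|l|).
    have := ler_normB t l; rewrite (gtr0_norm t0) => /le_trans; apply.
    by rewrite mulrDr mulr1 lerD2l ler_peMl.
  have lin (u v : R) : `|u * (t - l) + v| <= t * (`|u| * (1 + `|l|) + `|v|).
    apply: le_trans (ler_normD _ _) _; rewrite normrM mulrDr; apply: lerD.
      by rewrite mulrCA; apply: ler_wpM2l.
    by rewrite ler_peMl.
  have br : `|(p * (t - l) + p') * cos (b * t) + (r * (t - l) + r') * sin (b * t)| <= t * K.
    apply: le_trans (ler_normD _ _) _; rewrite !normrM.
    have -> : t * K = t * (`|p| * (1 + `|l|) + `|p'|) * 1 + t * (`|r| * (1 + `|l|) + `|r'|) * 1.
      by rewrite /K; ring.
    apply: lerD; apply: ler_pM => //; [exact: cos_max|exact: sin_max].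
  rewrite /wexp_prim normrM (ger0_norm (expR_ge0 _)).
  apply: (@le_trans _ _ (4 / (a * t) ^+ 2 * (t * K))).
    by apply: ler_pM => //; exact: expRN_mul_le.
  rewrite le_eqVlt; apply/orP; left; apply/eqP.
  by field; rewrite !gt_eqF.
apply/cvgr0Pnorm_lt => e e0; near=> t.
have t1 : 1 <= t by near: t; exact: nbhs_pinfty_ge.
have t0 : 0 < t by exact: lt_le_trans t1.
apply: le_lt_trans (bnd t t1) _.
rewrite ltr_pdivrMr// -ltr_pdivrMl//.
by near: t; apply: nbhs_pinfty_gt; rewrite num_real.
Unshelve. all: by end_near. Qed.

Local Notation leb := (@lebesgue_measure R).

(** Adding [wexp a 0] makes the integrand nonnegative. *)
Lemma integral_wexp_pair a b l : 0 < a ->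
  (\int[leb]_(t in `[l, +oo[) (wexp a 0 l t + wexp a b l t)%:E =
   (- (wexp_prim a 0 l l + wexp_prim a b l l))%:E)%E.
Proof.
move=> a0.
have dF t : is_derive t (1 : R) (fun t => wexp_prim a 0 l t + wexp_prim a b l t)
    (wexp a 0 l t + wexp a b l t).
  by apply: is_derive_addf; exact: is_derive_wexp_prim.
rewrite (@ge0_continuous_FTC2y R _ (fun t => wexp_prim a 0 l t + wexp_prim a b l t) l 0).
- by rewrite -EFinB sub0r.
- move=> t lt; rewrite /wexp mul0r cos0 mulr1 -[X in X + _]mulr1 -mulrDr.
  by rewrite mulr_ge0 ?mulr_ge0 ?subr_ge0 ?expR_ge0//.
- apply: continuous_subspaceT => t.
  by apply: cvgD; exact: continuous_wexp.
- rewrite -[X in _ --> X](addr0 0); apply: cvgD; exact: wexp_prim_cvg.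
- by move=> t _; have [] := dF t.
- apply: cvg_at_right_filter; apply: cvgD; exact: continuous_wexp_prim.
- by move=> t _; rewrite derive1E; have [_ ->] := dF t.
Qed.

Lemma measurable_wexp a b l (A : set R) : measurable_fun A (wexp a b l).
Proof.
by apply: measurable_funTS; apply: continuous_measurable_fun; exact: continuous_wexp.
Qed.

Lemma wexp0_ge0 a l t : l <= t -> 0 <= wexp a 0 l t.
Proof. by move=> lt; rewrite /wexp mul0r cos0 mulr1 mulr_ge0 ?subr_ge0 ?expR_ge0. Qed.

Lemma norm_wexp_le a b l t : l <= t -> `|wexp a b l t| <= wexp a 0 l t.
Proof.
move=> lt; rewrite /wexp mul0r cos0 mulr1 normrM ger0_norm ?mulr_ge0 ?subr_ge0 ?expR_ge0//.
by rewrite ler_piMr ?mulr_ge0 ?subr_ge0 ?expR_ge0 ?cos_max.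
Qed.

Lemma integrable_wexp a b l : 0 < a -> leb.-integrable `[l, +oo[ (EFin \o wexp a b l).
Proof.
move=> a0.
have i0 : leb.-integrable `[l, +oo[ (EFin \o (fun t => wexp a 0 l t + wexp a 0 l t)).
  apply/integrableP; split.
    by apply/measurable_EFinP; apply: measurable_funD; exact: measurable_wexp.
  rewrite [X in (X < _)%E](_ : _ =
      (\int[leb]_(t in `[l, +oo[) (wexp a 0 l t + wexp a 0 l t)%:E)%E).
    by rewrite integral_wexp_pair// ltry.
  apply: eq_integral => t; rewrite inE/= in_itv/= andbT => lt.
  by rewrite ger0_norm// addr_ge0// wexp0_ge0.
apply: (le_integrable _ _ _ i0) => //=.
  by apply/measurable_EFinP; exact: measurable_wexp.
move=> t /=; rewrite in_itv/= andbT => lt; rewrite lee_fin.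
apply: le_trans (norm_wexp_le a b lt) _.
by rewrite ger0_norm ?addr_ge0 ?wexp0_ge0// lerDl wexp0_ge0.
Qed.

Lemma Rintegral_wexp a b l : 0 < a ->
  \int[leb]_(t in `[l, +oo[) wexp a b l t = - wexp_prim a b l l.
Proof.
move=> a0.
have h b' : \int[leb]_(t in `[l, +oo[) wexp a 0 l t + \int[leb]_(t in `[l, +oo[) wexp a b' l t
   = - (wexp_prim a 0 l l + wexp_prim a b' l l).
  rewrite -RintegralD//; [|exact: integrable_wexp|exact: integrable_wexp].
  by rewrite /Rintegral integral_wexp_pair.
move: (h b) (h 0); move: (\int[leb]_(t in _) wexp a 0 l t) => x.
by move: (\int[leb]_(t in _) wexp a b l t) => y hb h0; lra.
Qed.

Lemma Rintegral_wexp_le a b l : 0 < a ->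
  `|\int[leb]_(t in `[l, +oo[) wexp a b l t| <= 2 * expR (- a * l) / (a ^+ 2 + b ^+ 2).
Proof.
move=> a0; rewrite Rintegral_wexp// normrN /wexp_prim subrr !mulr0 sub0r add0r.
have D0 := D_gt0 b a0; rewrite -/(D a b).
rewrite normrM (ger0_norm (expR_ge0 _)) [leRHS]mulrAC [leRHS]mulrC; apply: ler_wpM2l.
  exact: expR_ge0.
have h1 : `|- ((a ^+ 2 - b ^+ 2) / D a b ^+ 2)| <= (D a b)^-1.
  rewrite normrN normrM (ger0_norm (_ : 0 <= (D a b ^+ 2)^-1)) ?invr_ge0 ?sqr_ge0//.
  rewrite ler_pdivrMr ?exprn_gt0// expr2 mulKf ?gt_eqF//.
  rewrite ler_norml /D; have := sqr_ge0 a; have := sqr_ge0 b; lra.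
have h2 : `|2 * a * b / D a b ^+ 2| <= (D a b)^-1.
  rewrite normrM (ger0_norm (_ : 0 <= (D a b ^+ 2)^-1)) ?invr_ge0 ?sqr_ge0//.
  rewrite ler_pdivrMr ?exprn_gt0// expr2 mulKf ?gt_eqF//.
  rewrite ler_norml /D; have := sqr_ge0 (a - b); have := sqr_ge0 (a + b); lra.
apply: le_trans (ler_normD _ _) _; rewrite [leRHS]mulr_natl [leRHS]mulr2n.
apply: lerD; rewrite normrM -[leRHS]mulr1; apply: ler_pM => //.
  exact: cos_max.
exact: sin_max.
Qed.

End weighted_exponential.
(** * The large sieve inequality for Laplace transforms *)

Section Rintegral_lemmas.
Context d (T : measurableType d) (R : realType) (mu : {measure set T -> \bar R}).

Lemma integrable_sum_fin (I : Type) (s : seq I) (D : set T) (F : I -> T -> R) :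
  measurable D -> (forall i, mu.-integrable D (EFin \o F i)) ->
  mu.-integrable D (EFin \o (fun t => \sum_(i <- s) F i t)).
Proof.
move=> mD iF; have -> : EFin \o (fun t => \sum_(i <- s) F i t) =
    (fun t => (\sum_(i <- s) (EFin \o F i) t)%E).
  by apply/funext => t; rewrite /= sumEFin.
by apply: integrable_sum.
Qed.

Lemma Rintegral_sum (I : Type) (s : seq I) (D : set T) (F : I -> T -> R) :
  measurable D -> (forall i, mu.-integrable D (EFin \o F i)) ->
  \int[mu]_(t in D) (\sum_(i <- s) F i t) = \sum_(i <- s) \int[mu]_(t in D) F i t.
Proof.
move=> mD iF; elim: s => [|i s IH].
  rewrite big_nil; under eq_Rintegral do rewrite big_nil.
  by rewrite Rintegral_cst// mul0r.
rewrite big_cons -IH -RintegralD//; last exact: integrable_sum_fin.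
by apply: eq_Rintegral => t _; rewrite big_cons.
Qed.

Lemma le_Rintegral_subset (D E : set T) (g : T -> R) :
  measurable D -> measurable E -> D `<=` E -> (forall t, E t -> 0 <= g t) ->
  mu.-integrable E (EFin \o g) ->
  \int[mu]_(t in D) g t <= \int[mu]_(t in E) g t.
Proof.
move=> mD mE DE g0 ig; apply: fine_le.
- exact: (integrable_fin_num mD (integrableS mE mD DE ig)).
- exact: integrable_fin_num.
- by apply: ge0_subset_integral => //; have /integrableP[] := ig.
Qed.

End Rintegral_lemmas.

(** The heights [y k] lie in distinct cells of a grid of mesh [h]. *)
Lemma sum_inv_sqr_box {R : realType} (h v : R) (y : int -> R) (s : seq int) :
  0 < h -> uniq s -> (forall k, k \in s -> k%:~R * h <= y k <= k%:~R * h + h) ->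
  \sum_(k <- s) (h ^+ 2 + (v - y k) ^+ 2)^-1 <= 128 / h ^+ 2.
Proof.
move=> h0 us hy.
apply: (@le_trans _ _ (\sum_(k <- s) 8 / h ^+ 2 * ((1 + `|k%:~R - v / h|) ^+ 2)^-1)).
  rewrite big_seq [leRHS]big_seq; apply: ler_sum => k ks.
  have /andP[y1 y2] := hy _ ks.
  have b0 := normr_ge0 (k%:~R - v / h).
  set b := `|k%:~R - v / h| in b0 *.
  have hb : h * (1 + b) <= 2 * (h + `|v - y k|).
    have -> : h * (1 + b) = h + `|k%:~R * h - v|.
      rewrite mulrDr mulr1 /b -{2}(gtr0_norm h0) -normrM; congr (_ + `|_|).
      by field; rewrite gt_eqF.
    have h1 : `|k%:~R * h - y k| <= h by rewrite ler_norml; lra.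
    have := ler_distD (y k) (k%:~R * h) v; rewrite (distrC (y k) v).
    by have := normr_ge0 (v - y k); lra.
  have p1 : 0 < h ^+ 2 + (v - y k) ^+ 2 by rewrite ltr_pwDl ?exprn_gt0 ?sqr_ge0.
  have p2 : 0 < 1 + b by rewrite ltr_pwDl.
  have p3 : 0 < h * (1 + b) by rewrite mulr_gt0.
  have -> : 8 / h ^+ 2 * ((1 + b) ^+ 2)^-1 = 8 / (h * (1 + b)) ^+ 2.
    by field; rewrite !gt_eqF.
  rewrite ler_pdivlMr ?exprn_gt0// ler_pdivrMl//.
  rewrite -(real_normK (num_real (v - y k))).
  have v0 := normr_ge0 (v - y k); move: `|v - y k| v0 hb => d d0 hb.
  have : (h * (1 + b)) ^+ 2 <= (2 * (h + d)) ^+ 2.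
    by rewrite ler_sqr// nnegrE ?mulr_ge0 ?addr_ge0// ltW.
  by have := sqr_ge0 (h - d); lra.
rewrite -mulr_sumr; apply: (@le_trans _ _ (8 / h ^+ 2 * (16 / 1))).
  by apply: ler_wpM2l; [rewrite divr_ge0// exprn_ge0// ltW|exact: sum_inv_sqr_int].
by lra.
Qed.

Section exponential_posreals.
Context {R : realType}.
Local Notation leb := (@lebesgue_measure R).

Lemma continuous_expR_affine (x : R) : continuous (fun t : R => expR (- x * t)).
Proof.
move=> t; apply: (@continuous_comp _ _ _ (fun t => - x * t) expR); last exact: continuous_expR.
by apply: cvgMr; exact: cvg_id.
Qed.

Lemma measurable_posreals : measurable (posreals : set (measurableTypeR R)).
Proof. exact: measurable_itv. Qed.

Lemma posreals_gt0 (t : R) : posreals t <-> 0 < t.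
Proof. by rewrite /posreals/= in_itv/= andbT. Qed.

(** On [posreals] the exponential is dominated by the weight [wexp]. *)
Lemma expR_le_wexp (h t : R) : 0 < h -> 0 < t ->
  expR (- h * t) <= h * wexp h 0 (- h^-1) t.
Proof.
move=> h0 t0; rewrite /wexp mul0r cos0 mulr1 mulrA opprK.
by rewrite ler_peMl ?expR_ge0// mulrDr divff ?gt_eqF// lerDr mulr_ge0// ltW.
Qed.

Let posreals_sub (l : R) : l <= 0 -> posreals `<=` `[l, +oo[%classic.
Proof.
move=> l0 t /posreals_gt0 t0; rewrite /= in_itv/= andbT.
by rewrite (le_trans l0)// ltW.
Qed.

Lemma integrable_expR_posreals (h : R) : 0 < h ->
  leb.-integrable posreals (EFin \o (fun t => expR (- h * t))).
Proof.
move=> h0.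
have l0 : - h^-1 <= 0 by rewrite oppr_le0 invr_ge0 ltW.
have mI : measurable (`[- h^-1, +oo[%classic : set (measurableTypeR R)) by exact: measurable_itv.
have i1 := integrableS mI measurable_posreals (posreals_sub l0) (integrable_wexp 0 (- h^-1) h0).
have i2 := integrableZl measurable_posreals h i1.
apply: (le_integrable measurable_posreals _ _ i2).
  apply/measurable_EFinP; apply: measurable_funTS; apply: continuous_measurable_fun.
  exact: continuous_expR_affine.
move=> t /posreals_gt0 t0 /=; rewrite lee_fin ger0_norm ?expR_ge0//.
exact: le_trans (expR_le_wexp h0 t0) (ler_norm _).
Qed.

Lemma Rintegral_expR_posreals (h : R) : 0 < h ->
  \int[leb]_(t in posreals) expR (- h * t) <= 2 * expR 1 / h.
Proof.
move=> h0.
have l0 : - h^-1 <= 0 by rewrite oppr_le0 invr_ge0 ltW.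
have mI : measurable (`[- h^-1, +oo[%classic : set (measurableTypeR R)) by exact: measurable_itv.
have iw := integrable_wexp 0 (- h^-1) h0.
have ip := integrableS mI measurable_posreals (posreals_sub l0) iw.
apply: (@le_trans _ _ (h * \int[leb]_(t in posreals) wexp h 0 (- h^-1) t)).
  rewrite -(RintegralZl h measurable_posreals ip); apply: le_Rintegral.
  - exact: measurable_posreals.
  - exact: integrable_expR_posreals.
  - exact: (integrableZl measurable_posreals h ip).
  - by move=> t /posreals_gt0 t0; exact: expR_le_wexp.
apply: (@le_trans _ _ (h * \int[leb]_(t in `[- h^-1, +oo[) wexp h 0 (- h^-1) t)).
  apply: ler_wpM2l; first exact: ltW.
  apply: le_Rintegral_subset => //; first exact: measurable_posreals.
    exact: posreals_sub.
  by move=> t; rewrite /= in_itv/= andbT; exact: wexp0_ge0.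
apply: (@le_trans _ _ (h * (2 * expR (- h * - h^-1) / (h ^+ 2 + 0 ^+ 2)))).
  apply: ler_wpM2l; first exact: ltW.
  by apply: le_trans (ler_norm _) _; exact: Rintegral_wexp_le.
rewrite mulrNN divff ?gt_eqF// expr0n addr0 le_eqVlt; apply/orP; left; apply/eqP.
by field; rewrite gt_eqF.
Qed.

Lemma integrable_bounded_exp (f g : R -> R) (M h : R) : 0 < h ->
  measurable_fun posreals f -> (forall t, 0 < t -> `|f t| <= M) ->
  measurable_fun posreals g -> (forall t, 0 < t -> `|g t| <= expR (- h * t)) ->
  leb.-integrable posreals (EFin \o (fun t => f t * g t)).
Proof.
move=> h0 mf fM mg ge.
have i2 := integrableZl measurable_posreals M (integrable_expR_posreals h0).
apply: (le_integrable measurable_posreals _ _ i2).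
  by apply/measurable_EFinP; exact: measurable_funM.
move=> t /posreals_gt0 t0 /=; rewrite lee_fin normrM.
rewrite [leRHS]normrM; apply: ler_pM => //.
  exact: le_trans (fM _ t0) (ler_norm _).
exact: le_trans (ge _ t0) (ler_norm _).
Qed.

End exponential_posreals.

(** The arithmetic-geometric inequality with weight [w] and parameter [L]. *)
Lemma mul_le_weighted {R : realType} (u v M L w : R) : 0 < L -> 0 < w -> `|u| <= M ->
  u * v <= L / 2 * M ^+ 2 / w + (2 * L)^-1 * (w * v ^+ 2).
Proof.
move=> L0 w0 uM; apply: (@le_trans _ _ (M * `|v|)).
  by apply: le_trans (ler_norm _) _; rewrite normrM; exact: ler_wpM2r.
rewrite -(real_normK (num_real v)); have [V VE] : exists V : R, V = `|v| by exists `|v|.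
rewrite -VE -subr_ge0.
have -> : L / 2 * M ^+ 2 / w + (2 * L)^-1 * (w * V ^+ 2) - M * V =
   (L * M - w * V) ^+ 2 / (2 * L * w).
  by field; rewrite !gt_eqF.
apply: divr_ge0; first exact: sqr_ge0.
by apply: mulr_ge0; [apply: mulr_ge0 => //; exact: ltW|exact: ltW].
Qed.

Section trig_sieve.
Context {R : realType}.
Local Notation leb := (@lebesgue_measure R).
(** [T] stands for [cos] or [sin], with [e] equal to [1] or [-1]. *)
Variables (T : R -> R) (e : R).
Context (Tcont : continuous T) (Tle1 : forall u, `|T u| <= 1) (e1 : `|e| <= 1)
  (Tmul : forall u v, T u * T v = (cos (u - v) + e * cos (u + v)) / 2).

(** The real or imaginary part, up to sign, of [exp (- (x + i y) t)]. *)
Definition trig_exp (x y t : R) : R := expR (- x * t) * T (y * t).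

Lemma continuous_trig_exp x y : continuous (trig_exp x y).
Proof.
move=> t; apply: cvgM; first exact: continuous_expR_affine.
apply: (@continuous_comp _ _ _ (fun t => y * t) T); last exact: Tcont.
by apply: cvgMr; exact: cvg_id.
Qed.

Lemma trig_exp_le x y h t : h <= x -> 0 < t -> `|trig_exp x y t| <= expR (- h * t).
Proof.
move=> hx t0; rewrite /trig_exp normrM ger0_norm ?expR_ge0//.
rewrite -[leRHS]mulr1; apply: ler_pM => //.
by rewrite ler_expR ler_pM2r// lerN2.
Qed.

Let W (h t : R) : R := (t + h^-1) * expR (h * t).

Let W_ge0 h t : 0 < h -> - h^-1 <= t -> 0 <= W h t.
Proof. by move=> h0 ht; rewrite mulr_ge0 ?expR_ge0// -lerBlDr sub0r. Qed.

(** The Gram kernel of the functions [trig_exp] for the weight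
    [(t + 1 / h) exp (h t)] on [[- 1 / h, +oo)] is a combination of two
    integrals of [wexp]. *)
Let gram_split h x1 y1 x2 y2 t :
  W h t * (trig_exp x1 y1 t * trig_exp x2 y2 t) =
  (wexp (x1 + x2 - h) (y1 - y2) (- h^-1) t +
   e * wexp (x1 + x2 - h) (y1 + y2) (- h^-1) t) / 2.
Proof.
rewrite /wexp /trig_exp /W opprK.
have -> : expR (- (x1 + x2 - h) * t) = expR (h * t) * (expR (- x1 * t) * expR (- x2 * t)).
  by rewrite -!expRD; congr expR; ring.
have -> : (y1 - y2) * t = y1 * t - y2 * t by ring.
have -> : (y1 + y2) * t = y1 * t + y2 * t by ring.
have := Tmul (y1 * t) (y2 * t) => hT.
have -> : (t + h^-1) * expR (h * t) * (expR (- x1 * t) * T (y1 * t) * (expR (- x2 * t) * T (y2 * t))) =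
  (t + h^-1) * (expR (h * t) * (expR (- x1 * t) * expR (- x2 * t))) * (T (y1 * t) * T (y2 * t)) by ring.
rewrite hT; ring.
Qed.

Let gram_integrable h x1 y1 x2 y2 : 0 < h -> h <= x1 -> h <= x2 ->
  leb.-integrable `[- h^-1, +oo[
    (EFin \o (fun t => W h t * (trig_exp x1 y1 t * trig_exp x2 y2 t))).
Proof.
move=> h0 hx1 hx2; have a0 : 0 < x1 + x2 - h by lra.
have mI : measurable (`[- h^-1, +oo[%classic : set (measurableTypeR R)) by exact: measurable_itv.
have -> : EFin \o (fun t => W h t * (trig_exp x1 y1 t * trig_exp x2 y2 t)) =
  (fun t => (2^-1)%:E * ((wexp (x1 + x2 - h) (y1 - y2) (- h^-1) t)%:E +
   e%:E * (wexp (x1 + x2 - h) (y1 + y2) (- h^-1) t)%:E))%E.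
  by apply/funext => t; rewrite /= gram_split -EFinD -EFinM mulrC.
apply: (integrableZl mI).
apply: (integrableD mI (integrable_wexp _ _ a0)).
exact: (integrableZl mI _ (integrable_wexp _ _ a0)).
Qed.

Let gram_le h x1 y1 x2 y2 : 0 < h -> h <= x1 <= 2 * h -> h <= x2 <= 2 * h ->
  \int[leb]_(t in `[- h^-1, +oo[) (W h t * (trig_exp x1 y1 t * trig_exp x2 y2 t)) <=
  expR 3 * ((h ^+ 2 + (y1 - y2) ^+ 2)^-1 + (h ^+ 2 + (y1 + y2) ^+ 2)^-1) /\
  - (expR 3 * ((h ^+ 2 + (y1 - y2) ^+ 2)^-1 + (h ^+ 2 + (y1 + y2) ^+ 2)^-1)) <=
  \int[leb]_(t in `[- h^-1, +oo[) (W h t * (trig_exp x1 y1 t * trig_exp x2 y2 t)).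
Proof.
move=> h0 /andP[h1 h2] /andP[h3 h4]; have a0 : 0 < x1 + x2 - h by lra.
set a := x1 + x2 - h in a0 *.
have mI : measurable (`[- h^-1, +oo[%classic : set (measurableTypeR R)) by exact: measurable_itv.
have i1 := integrable_wexp (y1 - y2) (- h^-1) a0.
have i2 := integrable_wexp (y1 + y2) (- h^-1) a0.
have bnd b : `|\int[leb]_(t in `[- h^-1, +oo[) wexp a b (- h^-1) t| <=
    2 * expR 3 * (h ^+ 2 + b ^+ 2)^-1.
  apply: le_trans (Rintegral_wexp_le b (- h^-1) a0) _.
  have hb : 0 < h ^+ 2 + b ^+ 2 by rewrite ltr_pwDl ?exprn_gt0 ?sqr_ge0.
  have ha : h ^+ 2 + b ^+ 2 <= a ^+ 2 + b ^+ 2.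
    by rewrite lerD2r ler_sqr ?nnegrE ?(ltW h0) ?(ltW a0)//; rewrite /a; lra.
  apply: ler_pM => //.
  - by rewrite invr_ge0 (le_trans (ltW hb)).
  - rewrite ler_pM2l// ler_expR mulrNN ler_pdivrMr//; rewrite /a; lra.
  - by rewrite lef_pV2 ?posrE// (lt_le_trans hb).
have -> : \int[leb]_(t in `[- h^-1, +oo[) (W h t * (trig_exp x1 y1 t * trig_exp x2 y2 t)) =
  2^-1 * (\int[leb]_(t in `[- h^-1, +oo[) wexp a (y1 - y2) (- h^-1) t +
   e * \int[leb]_(t in `[- h^-1, +oo[) wexp a (y1 + y2) (- h^-1) t).
  rewrite -(RintegralZl e mI i2) -(RintegralD mI i1 (integrableZl mI e i2)).
  rewrite -RintegralZl//; last exact: (integrableD mI i1 (integrableZl mI e i2)).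
  by apply: eq_Rintegral => t _; rewrite gram_split mulrC.
have := bnd (y1 - y2); have := bnd (y1 + y2).
move: (\int[leb]_(t in _) wexp a (y1 - y2) _ t) => I1.
move: (\int[leb]_(t in _) wexp a (y1 + y2) _ t) => I2 b2 b1.
have eI2 : `|e * I2| <= 2 * expR 3 * (h ^+ 2 + (y1 + y2) ^+ 2)^-1.
  by rewrite normrM -[leRHS]mul1r; apply: ler_pM.
move: b1 eI2; rewrite !ler_norml => /andP[b1 b1'] /andP[b3 b3'].
by split; lra.
Qed.

(** The operator norm of the Gram matrix is at most its largest row sum. *)
Lemma weighted_bessel (h : R) (x y : int -> R) (s : seq int) (c : int -> R) :
  0 < h -> uniq s -> (forall k, k \in s -> h <= x k <= 2 * h) ->
  (forall k, k \in s -> k%:~R * h <= y k <= k%:~R * h + h) ->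
  leb.-integrable `[- h^-1, +oo[
    (EFin \o (fun t => W h t * (\sum_(k <- s) c k * trig_exp (x k) (y k) t) ^+ 2)) /\
  \int[leb]_(t in `[- h^-1, +oo[)
     (W h t * (\sum_(k <- s) c k * trig_exp (x k) (y k) t) ^+ 2) <=
  (256 * expR 3 / h ^+ 2) * \sum_(k <- s) c k ^+ 2.
Proof.
move=> h0 us hx hy.
have mI : measurable (`[- h^-1, +oo[%classic : set (measurableTypeR R)) by exact: measurable_itv.
pose x' k := if k \in s then x k else h.
have x'E k : k \in s -> x' k = x k by rewrite /x' => ->.
have hx' k : h <= x' k <= 2 * h.
  by rewrite /x'; case: ifPn => [/hx//|_]; rewrite lexx/=; lra.
pose F (p : int * int) t := c p.1 * c p.2 *
  (W h t * (trig_exp (x' p.1) (y p.1) t * trig_exp (x' p.2) (y p.2) t)).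
pose ss := [seq (j, k) | j <- s, k <- s].
have FE t : W h t * (\sum_(k <- s) c k * trig_exp (x k) (y k) t) ^+ 2 = \sum_(p <- ss) F p t.
  rewrite big_allpairs expr2 mulr_suml mulr_sumr; apply: eq_big_seq => j js.
  rewrite !mulr_sumr; apply: eq_big_seq => k ks.
  by rewrite /F/= !x'E//; ring.
have gi p : leb.-integrable `[- h^-1, +oo[ (EFin \o (fun t =>
    W h t * (trig_exp (x' p.1) (y p.1) t * trig_exp (x' p.2) (y p.2) t))).
  by apply: gram_integrable => //; [case/andP : (hx' p.1)|case/andP : (hx' p.2)].
have iF p : leb.-integrable `[- h^-1, +oo[ (EFin \o F p).
  exact: (integrableZl mI (c p.1 * c p.2) (gi p)).
split.
  rewrite (_ : (fun t => _) = (fun t => \sum_(p <- ss) F p t)); last exact/funext.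
  exact: integrable_sum_fin.
under eq_Rintegral do rewrite FE.
rewrite Rintegral_sum//.
pose N j k := expR 3 * ((h ^+ 2 + (y j - y k) ^+ 2)^-1 + (h ^+ 2 + (y j + y k) ^+ 2)^-1).
have Nsym j k : N j k = N k j.
  by rewrite /N -(sqrrN (y j - y k)) opprB (addrC (y j) (y k)).
have N0 j k : 0 <= N j k.
  by rewrite mulr_ge0 ?expR_ge0// addr_ge0// invr_ge0 addr_ge0 ?sqr_ge0.
have rowsum j : \sum_(k <- s) N j k <= 256 * expR 3 / h ^+ 2.
  rewrite -mulr_sumr big_split/=.
  have b1 := sum_inv_sqr_box (y j) h0 us hy.
  have b2 := sum_inv_sqr_box (- y j) h0 us hy.
  have e2 : \sum_(k <- s) (h ^+ 2 + (y j + y k) ^+ 2)^-1 =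
            \sum_(k <- s) (h ^+ 2 + (- y j - y k) ^+ 2)^-1.
    by apply: eq_bigr => k _; rewrite -(sqrrN (y j + y k)) opprD.
  rewrite e2; have e0 : 0 < expR 3 :> R by exact: expR_gt0.
  apply: (@le_trans _ _ (expR 3 * (128 / h ^+ 2 + 128 / h ^+ 2))).
    by rewrite ler_pM2l// lerD.
  lra.
apply: (@le_trans _ _ (\sum_(p <- ss) (c p.1 ^+ 2 + c p.2 ^+ 2) / 2 * N p.1 p.2)).
  apply: ler_sum => p _; rewrite RintegralZl//.
  have [g1 g2] := gram_le (y p.1) (y p.2) h0 (hx' p.1) (hx' p.2).
  move: g1 g2; rewrite -/(N p.1 p.2); have := N0 p.1 p.2.
  move: (N p.1 p.2) (\int[leb]_(t in _) _) (c p.1) (c p.2) => n I u v n0 g1 g2.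
  have In : `|I| <= n by rewrite ler_norml g1 g2.
  apply: le_trans (ler_norm _) _; rewrite normrM.
  apply: ler_pM => //; rewrite normrM ler_pdivlMr//.
  rewrite -(real_normK (num_real u)) -(real_normK (num_real v)).
  by have := sqr_ge0 (`|u| - `|v|); lra.
rewrite big_allpairs.
have -> : \sum_(j <- s) \sum_(k <- s) (c j ^+ 2 + c k ^+ 2) / 2 * N j k =
   \sum_(j <- s) c j ^+ 2 * \sum_(k <- s) N j k.
  have -> : \sum_(j <- s) \sum_(k <- s) (c j ^+ 2 + c k ^+ 2) / 2 * N j k =
    \sum_(j <- s) \sum_(k <- s) (c j ^+ 2 / 2 * N j k) +
    \sum_(j <- s) \sum_(k <- s) (c k ^+ 2 / 2 * N j k).
    rewrite -big_split; apply: eq_bigr => j _; rewrite -big_split.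
    by apply: eq_bigr => k _ /=; rewrite -mulrDl -mulrDl.
  rewrite [X in _ + X]exchange_big/= -big_split/=; apply: eq_bigr => j _.
  rewrite mulr_sumr -big_split; apply: eq_bigr => k _ /=.
  by rewrite (Nsym k j) -mulrDl -splitr.
rewrite mulr_sumr; apply: ler_sum => j _; rewrite [leRHS]mulrC.
by apply: ler_wpM2l; [exact: sqr_ge0|exact: rowsum].
Qed.

(** Duality: for [c k = int f phi_k] and [G = sum c k phi_k] one has
    [sum c k ^ 2 = int f G], which the arithmetic-geometric inequality splits
    into [int 1 / W] and [int W G ^ 2]; the latter is controlled by
    [weighted_bessel]. *)
Lemma large_sieve_trig (f : R -> R) (M h : R) (x y : int -> R) (s : seq int) :
  measurable_fun (posreals : set (measurableTypeR R)) f ->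
  (forall t, 0 < t -> `|f t| <= M) -> 0 < h -> uniq s ->
  (forall k, k \in s -> h <= x k <= 2 * h) ->
  (forall k, k \in s -> k%:~R * h <= y k <= k%:~R * h + h) ->
  \sum_(k <- s) (\int[leb]_(t in posreals) (f t * trig_exp (x k) (y k) t)) ^+ 2 <=
  512 * expR 3 * expR 1 / h ^+ 2 * M ^+ 2.
Proof.
move=> mf fM h0 us hx hy.
have mD := @measurable_posreals R.
have mI : measurable (`[- h^-1, +oo[%classic : set (measurableTypeR R)) by exact: measurable_itv.
pose c k := \int[leb]_(t in posreals) (f t * trig_exp (x k) (y k) t).
rewrite -/(c _); under eq_bigr do rewrite -/(c _).
set S := \sum_(k <- s) c k ^+ 2.
pose G t := \sum_(k <- s) c k * trig_exp (x k) (y k) t.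
have [iW WS] : leb.-integrable `[- h^-1, +oo[ (EFin \o (fun t => W h t * G t ^+ 2)) /\
    \int[leb]_(t in `[- h^-1, +oo[) (W h t * G t ^+ 2) <= (256 * expR 3 / h ^+ 2) * S.
  exact: weighted_bessel.
have DI : posreals `<=` (`[- h^-1, +oo[%classic : set R).
  move=> t /posreals_gt0 t0; rewrite /= in_itv/= andbT.
  by rewrite (le_trans _ (ltW t0))// oppr_le0 invr_ge0 ltW.
have iWD := integrableS mI mD DI iW.
pose x' k := if k \in s then x k else h.
have x'E k : k \in s -> x' k = x k by rewrite /x' => ->.
have ifx k : leb.-integrable posreals (EFin \o (fun t => f t * trig_exp (x' k) (y k) t)).
  apply: (integrable_bounded_exp h0 mf fM).
    by apply: measurable_funTS; apply: continuous_measurable_fun; exact: continuous_trig_exp.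
  move=> t t0; apply: trig_exp_le => //; rewrite /x'; case: ifPn => // /hx.
  by case/andP.
have fGE t : f t * G t = \sum_(k <- s) c k * (f t * trig_exp (x' k) (y k) t).
  rewrite mulr_sumr; apply: eq_big_seq => k ks; rewrite x'E//; ring.
have icx k : leb.-integrable posreals (EFin \o (fun t => c k * (f t * trig_exp (x' k) (y k) t))).
  exact: (integrableZl mD (c k) (ifx k)).
have ifG : leb.-integrable posreals (EFin \o (fun t => f t * G t)).
  rewrite (_ : (fun t => _) = (fun t => \sum_(k <- s) c k * (f t * trig_exp (x' k) (y k) t))).
    exact: integrable_sum_fin.
  exact/funext.
have SE : S = \int[leb]_(t in posreals) (f t * G t).
  under eq_Rintegral do rewrite fGE.
  rewrite Rintegral_sum//; apply: eq_big_seq => k ks.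
  rewrite (RintegralZl (c k) mD (ifx k)) expr2; congr (_ * _).
  by rewrite /c x'E.
have [L LE L0] : exists2 L : R, L = 256 * expR 3 / h ^+ 2 & 0 < L.
  exists (256 * expR 3 / h ^+ 2); first by [].
  have e30 : 0 < expR 3 :> R by exact: expR_gt0.
  by apply: divr_gt0; [apply: mulr_gt0; rewrite ?ltr0n|exact: exprn_gt0].
have L20 : 0 <= (2 * L)^-1 by rewrite invr_ge0 mulr_ge0// ltW.
have ie := integrable_expR_posreals h0.
have i1 := integrableZl mD (L / 2 * M ^+ 2 * h) ie.
have i2 := integrableZl mD ((2 * L)^-1) iWD.
have S_le : S <= (L / 2 * M ^+ 2 * h) * \int[leb]_(t in posreals) expR (- h * t) +
    (2 * L)^-1 * \int[leb]_(t in posreals) (W h t * G t ^+ 2).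
  rewrite {1}SE -(RintegralZl _ mD ie) -(RintegralZl _ mD iWD) -(RintegralD mD i1 i2).
  apply: le_Rintegral => //; first exact: (integrableD mD i1 i2).
  move=> t /posreals_gt0 t0.
  have := fM _ t0; move: (f t) (G t) => u v uM.
  pose w := expR (h * t) / h.
  have w0 : 0 < w by rewrite divr_gt0// expR_gt0.
  have wW : w * v ^+ 2 <= W h t * v ^+ 2.
    apply: ler_wpM2r; first exact: sqr_ge0.
    by rewrite /W /w mulrC ler_pM2r ?expR_gt0// lerDr ltW.
  have -> : L / 2 * M ^+ 2 * h * expR (- h * t) = L / 2 * M ^+ 2 / w.
    by rewrite /w mulNr expRN; field; rewrite gt_eqF//= gt_eqF ?expR_gt0.
  apply: (@le_trans _ _ (L / 2 * M ^+ 2 / w + (2 * L)^-1 * (w * v ^+ 2))); last first.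
    by rewrite lerD2l; exact: (ler_wpM2l L20).
  exact: mul_le_weighted.
have I1 := Rintegral_expR_posreals h0.
have I2 : \int[leb]_(t in posreals) (W h t * G t ^+ 2) <= L * S.
  rewrite LE; apply: le_trans _ WS; apply: le_Rintegral_subset => //.
  move=> t; rewrite /= in_itv/= andbT => ht.
  by rewrite mulr_ge0 ?sqr_ge0//; exact: W_ge0.
have LM0 : 0 <= L / 2 * M ^+ 2 * h.
  apply: mulr_ge0; last exact: ltW.
  by apply: mulr_ge0; [apply: divr_ge0 => //; exact: ltW|exact: sqr_ge0].
have h1 := ler_wpM2l LM0 I1; have h2 := ler_wpM2l L20 I2.
have e1' : L / 2 * M ^+ 2 * h * (2 * expR 1 / h) = L * expR 1 * M ^+ 2.
  by field; rewrite gt_eqF.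
have e2 : (2 * L)^-1 * (L * S) = S / 2 by field; rewrite gt_eqF.
rewrite e1' in h1; rewrite e2 in h2.
have -> : 512 * expR 3 * expR 1 / h ^+ 2 * M ^+ 2 = 2 * (L * expR 1 * M ^+ 2).
  by rewrite LE; field; rewrite gt_eqF.
have h3 := le_trans S_le (lerD h1 h2).
move: (L * expR 1 * M ^+ 2) h3 => Z h3; lra.
Qed.

End trig_sieve.
(** * Componentwise form of the Laplace transform *)

Section laplace_components.
Context {R : realType}.
Local Notation leb := (@lebesgue_measure R).
Implicit Types (f g : R -> R) (x y t M : R).

(** The Laplace transform of a real function paired with [cos] or [sin]. *)
Definition trig_laplace (T : R -> R) f x y : R :=
  \int[leb]_(t in posreals) (f t * trig_exp T x y t).

(** Truncation at height [M]. *)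
Definition clip M f t : R := Num.max (- M) (Num.min (f t) M).

Lemma clip_le M f t : 0 <= M -> `|clip M f t| <= M.
Proof.
move=> M0; rewrite /clip ler_norml le_max lexx/= ge_max ge_min lexx orbT andbT.
by rewrite (le_trans _ M0)// oppr_le0.
Qed.

Lemma clip_id M f t : `|f t| <= M -> clip M f t = f t.
Proof.
rewrite ler_norml => /andP[h1 h2].
by rewrite /clip (min_idPl h2) (max_idPr h1).
Qed.

Lemma measurable_clip M f (D : set (measurableTypeR R)) :
  measurable_fun D f -> measurable_fun D (clip M f).
Proof.
move=> mf; apply: measurable_maxr; first exact: measurable_cst.
by apply: measurable_minr => //; exact: measurable_cst.
Qed.

Variables (T : R -> R).
Context (Tcont : continuous T) (Tle1 : forall u, `|T u| <= 1).

Lemma measurable_trig_exp x y (D : set (measurableTypeR R)) :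
  measurable_fun D (trig_exp T x y).
Proof.
by apply: measurable_funTS; apply: continuous_measurable_fun; exact: continuous_trig_exp.
Qed.

Lemma integrable_trig_laplace f M x y : 0 < x ->
  measurable_fun (posreals : set (measurableTypeR R)) f ->
  (forall t, 0 < t -> `|f t| <= M) ->
  leb.-integrable posreals (EFin \o (fun t => f t * trig_exp T x y t)).
Proof.
move=> x0 mf fM; apply: (integrable_bounded_exp x0 mf fM).
  exact: measurable_trig_exp.
by move=> t t0; apply: trig_exp_le.
Qed.

(** Joint measurability and Tonelli's theorem, applied to the positive and the
    negative part of the integrand. *)
Lemma measurable_trig_laplace f :
  measurable_fun (posreals : set (measurableTypeR R)) f ->
  measurable_fun [set: R * R] (fun w : R * R => trig_laplace T f w.1 w.2).
Proof.
move=> mf.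
pose F (p : (R * R) * measurableTypeR R) : \bar R :=
  ((f \_ posreals) p.2 * trig_exp T p.1.1 p.1.2 p.2)%:E.
have mF : measurable_fun setT F.
  apply/measurable_EFinP; apply: measurable_funM.
    apply: (measurableT_comp (f := f \_ posreals)); last exact: measurable_snd.
    by apply/(measurable_restrictT _ (@measurable_posreals R)).
  have m2 : measurable_fun setT (fun p : (R * R) * measurableTypeR R => p.2 : R).
    exact: measurable_snd.
  have m11 : measurable_fun setT (fun p : (R * R) * measurableTypeR R => p.1.1).
    by apply: measurableT_comp; [exact: measurable_fst|exact: measurable_fst].
  have m12 : measurable_fun setT (fun p : (R * R) * measurableTypeR R => p.1.2).
    by apply: measurableT_comp; [exact: measurable_snd|exact: measurable_fst].
  apply: measurable_funM.
    apply: (measurableT_comp (f := expR)); first exact: measurable_expR.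
    by apply: measurable_funM => //; apply: measurableT_comp m11.
  apply: (measurableT_comp (f := T)); first exact: continuous_measurable_fun.
  exact: measurable_funM.
rewrite (_ : (fun w : R * R => _) =
   (fun w => fine (\int[leb]_t F^\+ (w, t) - \int[leb]_t F^\- (w, t))%E)).
  apply: (measurableT_comp (f := fine)) => //.
  apply: emeasurable_funB.
    apply: (@measurable_fun_fubini_tonelli_F _ _ _ _ _ leb (F^\+)%E).
      exact: measurable_funepos.
    by move=> p; exact: funepos_ge0.
  apply: (@measurable_fun_fubini_tonelli_F _ _ _ _ _ leb (F^\-)%E).
    exact: measurable_funeneg.
  by move=> p; exact: funeneg_ge0.
apply/funext => w; rewrite /trig_laplace /Rintegral; congr fine.
rewrite integral_mkcond integralE; congr (_ - _)%E; apply: eq_integral => t _.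
  rewrite !funeposE /F /patch /=; case: ifPn => //; by rewrite mul0r.
rewrite !funenegE /F /patch /=; case: ifPn => //; by rewrite mul0r.
Qed.

End laplace_components.

Section laplace_complex.
Context {R : realType}.
Local Notation leb := (@lebesgue_measure R).

Lemma cos_le1 (u : R) : `|cos u| <= 1. Proof. exact: cos_max. Qed.
Lemma sin_le1 (u : R) : `|sin u| <= 1. Proof. exact: sin_max. Qed.

Lemma cos_mul_cos (u v : R) : cos u * cos v = (cos (u - v) + 1 * cos (u + v)) / 2.
Proof. by rewrite cosB cosD; field. Qed.

Lemma sin_mul_sin (u v : R) : sin u * sin v = (cos (u - v) + -1 * cos (u + v)) / 2.
Proof. by rewrite cosB cosD; field. Qed.

Lemma laplace_integrand (f : R -> R[i]) (w : R * R) (t : R) :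
  cexp (- toC w * t%:C%C) * f t =
  ((complex.Re (f t) * trig_exp cos w.1 w.2 t + complex.Im (f t) * trig_exp sin w.1 w.2 t)
  +i* (complex.Im (f t) * trig_exp cos w.1 w.2 t - complex.Re (f t) * trig_exp sin w.1 w.2 t))%C.
Proof.
case: (f t) => a b; rewrite /cexp /toC /trig_exp /=.
have -> : - w.1 * t - - w.2 * 0 = - w.1 * t by ring.
have -> : - w.1 * 0 + - w.2 * t = - (w.2 * t) by ring.
rewrite cosN sinN; congr (_ +i* _)%C; ring.
Qed.

(** An essentially bounded function is almost everywhere equal to its
    truncation, which is bounded everywhere. *)
Lemma laplaceE (f : R -> R[i]) (M : R) (w : R * R) : 0 < w.1 ->
  measurable_fun (posreals : set (measurableTypeR R)) (fun t => complex.Re (f t)) ->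
  measurable_fun (posreals : set (measurableTypeR R)) (fun t => complex.Im (f t)) ->
  (\forall t \ae leb, posreals t -> Normc.normc (f t) <= M) -> 0 <= M ->
  let fr := clip M (fun t => complex.Re (f t)) in
  let fi := clip M (fun t => complex.Im (f t)) in
  laplace f (toC w) =
    ((trig_laplace cos fr w.1 w.2 + trig_laplace sin fi w.1 w.2)
    +i* (trig_laplace cos fi w.1 w.2 - trig_laplace sin fr w.1 w.2))%C.
Proof.
move=> w0 mr mi fM M0 fr fi.
have Re_le (z : R[i]) : `|complex.Re z| <= Normc.normc z.
  by case: z => a b /=; rewrite -sqrtr_sqr ler_wsqrtr// lerDl sqr_ge0.
have Im_le (z : R[i]) : `|complex.Im z| <= Normc.normc z.
  by case: z => a b /=; rewrite -sqrtr_sqr ler_wsqrtr// lerDr sqr_ge0.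
have mfr : measurable_fun (posreals : set (measurableTypeR R)) fr by exact: measurable_clip.
have mfi : measurable_fun (posreals : set (measurableTypeR R)) fi by exact: measurable_clip.
have frM t : 0 < t -> `|fr t| <= M by move=> _; exact: clip_le.
have fiM t : 0 < t -> `|fi t| <= M by move=> _; exact: clip_le.
have mD := @measurable_posreals R.
have cc := @continuous_cos R. have cs := @continuous_sin R.
have irc := integrable_trig_laplace cc cos_le1 w.2 w0 mfr frM.
have irs := integrable_trig_laplace cs sin_le1 w.2 w0 mfr frM.
have iic := integrable_trig_laplace cc cos_le1 w.2 w0 mfi fiM.
have iis := integrable_trig_laplace cs sin_le1 w.2 w0 mfi fiM.
have mT T (h : R -> R) : continuous T -> measurable_fun (posreals : set (measurableTypeR R)) h ->
    measurable_fun (posreals : set (measurableTypeR R)) (fun t => h t * trig_exp T w.1 w.2 t).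
  by move=> cT mh; apply: measurable_funM => //; exact: measurable_trig_exp.
have fE : \forall t \ae leb, posreals t ->
    fr t = complex.Re (f t) /\ fi t = complex.Im (f t).
  case: fM => N [mN N0 sN]; exists N; split => //.
  apply: subset_trans sN => t /= h fMt; apply: h => Dt.
  by rewrite /fr /fi !clip_id// (le_trans _ (fMt Dt)).
rewrite /trig_laplace -(RintegralD mD irc iis) -(RintegralB mD iic irs).
rewrite /laplace /cintegral /Rintegral; congr (fine _ +i* fine _)%C; apply: ae_eq_integral.
- exact: measurable_posreals.
- apply/measurable_EFinP; under eq_fun do rewrite laplace_integrand/=.
  by apply: measurable_funD; exact: mT.
- by apply/measurable_EFinP; apply: measurable_funD; exact: mT.
- case: fE => N [mN N0 sN]; exists N; split => //.
  apply: subset_trans sN => t /= h fEt; apply: h => Dt.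
  by rewrite laplace_integrand/=; have [-> ->] := fEt Dt.
- exact: measurable_posreals.
- apply/measurable_EFinP; under eq_fun do rewrite laplace_integrand/=.
  by apply: measurable_funB; exact: mT.
- by apply/measurable_EFinP; apply: measurable_funB; exact: mT.
- case: fE => N [mN N0 sN]; exists N; split => //.
  apply: subset_trans sN => t /= h fEt; apply: h => Dt.
  by rewrite laplace_integrand/=; have [-> ->] := fEt Dt.
Qed.

End laplace_complex.
(** * The embedding bound from the dyadic sum *)

(** The constant of [laplace_large_sieve]. *)
Definition sieve_const {R : realType} : R := 8 * (512 * expR 3 * expR 1).

Lemma sieve_const_gt0 {R : realType} : 0 < sieve_const :> R.
Proof.
have c8 : 0 < 8 :> R by rewrite ltr0n.
have c512 : 0 < 512 :> R by rewrite ltr0n.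
exact: (mulr_gt0 c8 (mulr_gt0 (mulr_gt0 c512 (expR_gt0 3)) (expR_gt0 1))).
Qed.

Section laplace_upper.
Context {R : realType}.
Local Notation leb := (@lebesgue_measure R).

Lemma lebesgue_setT_gt0 : (0 < leb setT)%E.
Proof.
apply: (@lt_le_trans _ _ (leb `[0, 1]%classic)).
  by rewrite lebesgue_measure_itv/= lte_fin ltr01 oppr0 adde0 lte_fin.
by apply: le_measure => //; rewrite inE//; exact: measurable_itv.
Qed.

Lemma cLspace_oo_bound (f : R -> R[i]) : cLspace leb posreals +oo%E f ->
  exists M : R, [/\ 0 <= M, cLnorm leb posreals +oo%E f = M%:E &
    \forall t \ae leb, posreals t -> Normc.normc (f t) <= M].
Proof.
move=> [_ foo].
have N0 : (0 <= cLnorm leb posreals +oo%E f)%E by exact: Lnorm_ge0.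
have Nfin : cLnorm leb posreals +oo%E f \is a fin_num by rewrite ge0_fin_numE.
exists (fine (cLnorm leb posreals +oo%E f)); split; first exact: fine_ge0.
  by rewrite fineK.
pose g : R -> \bar R := (fun t => (Normc.normc (f t))%:E) \_ posreals.
have Ng : cLnorm leb posreals +oo%E f = ess_sup leb (abse \o g).
  by rewrite /cLnorm unlock /= lebesgue_setT_gt0.
have [N [mN N0' sN]] := ess_sup_ge leb (abse \o g).
exists N; split => //; apply: subset_trans sN => t /= h gt; apply: h => Dt.
move: gt; rewrite -Ng -[X in (_ <= X)%E]fineK// /g /patch mem_set//= lee_fin.
by apply: le_trans; exact: ler_norm.
Qed.

Variable f : R -> R[i].
Variable M : R.
Context (M0 : 0 <= M)
  (mr : measurable_fun (posreals : set (measurableTypeR R)) (fun t => complex.Re (f t)))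
  (mi : measurable_fun (posreals : set (measurableTypeR R)) (fun t => complex.Im (f t)))
  (fM : \forall t \ae leb, posreals t -> Normc.normc (f t) <= M).

Let fr := clip M (fun t => complex.Re (f t)).
Let fi := clip M (fun t => complex.Im (f t)).
Let mfr : measurable_fun (posreals : set (measurableTypeR R)) fr.
Proof. exact: measurable_clip. Qed.
Let mfi : measurable_fun (posreals : set (measurableTypeR R)) fi.
Proof. exact: measurable_clip. Qed.
Let frM t : 0 < t -> `|fr t| <= M. Proof. by move=> _; exact: clip_le. Qed.
Let fiM t : 0 < t -> `|fi t| <= M. Proof. by move=> _; exact: clip_le. Qed.

Lemma cmeasurable_laplace :
  cmeasurable (Cplus : set (R * R)) (fun w : R * R => laplace f (toC w)).
Proof.
have cc := @continuous_cos R. have cs := @continuous_sin R.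
split.
- apply: (@eq_measurable_fun _ _ _ _ _ (fun w : R * R =>
    trig_laplace cos fr w.1 w.2 + trig_laplace sin fi w.1 w.2)).
    by move=> w; rewrite inE => w0; rewrite (laplaceE w0 mr mi fM M0).
  by apply: measurable_funTS; apply: measurable_funD; exact: measurable_trig_laplace.
- apply: (@eq_measurable_fun _ _ _ _ _ (fun w : R * R =>
    trig_laplace cos fi w.1 w.2 - trig_laplace sin fr w.1 w.2)).
    by move=> w; rewrite inE => w0; rewrite (laplaceE w0 mr mi fM M0).
  by apply: measurable_funTS; apply: measurable_funB; exact: measurable_trig_laplace.
Qed.

Local Notation N2 := (fun w : R * R => Normc.normc (laplace f (toC w)) ^+ 2).
Local Notation K := (@sieve_const R).

(** At most one point [z k] is taken in each box of the strip [n], and the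
    points of boxes with distinct indices are spread out vertically. *)
Lemma laplace_large_sieve (n : int) (z : int -> R * R) (s : seq int) : uniq s ->
  (forall k, k \in s -> box n (k%:~R * dyad n) (z k)) ->
  \sum_(k <- s) N2 (z k) <= K / dyad n ^+ 2 * M ^+ 2.
Proof.
move=> us hz.
have cc := @continuous_cos R. have cs := @continuous_sin R.
have e0 : `|-1| <= 1 :> R by rewrite normrN normr1.
have e1 : `|1| <= 1 :> R by rewrite normr1.
have hx k : k \in s -> dyad n <= (z k).1 <= 2 * dyad n.
  by move=> /hz [/andP[h1 h2] _]; rewrite h1/= -dyadS ltW.
have hy k : k \in s -> k%:~R * dyad n <= (z k).2 <= k%:~R * dyad n + dyad n.
  by move=> /hz [_ /andP[h1 h2]]; rewrite h1/= ltW.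
have b1 := large_sieve_trig cc cos_le1 e1 cos_mul_cos mfr frM (dyad_gt0 n) us hx hy.
have b2 := large_sieve_trig cc cos_le1 e1 cos_mul_cos mfi fiM (dyad_gt0 n) us hx hy.
have b3 := large_sieve_trig cs sin_le1 e0 sin_mul_sin mfr frM (dyad_gt0 n) us hx hy.
have b4 := large_sieve_trig cs sin_le1 e0 sin_mul_sin mfi fiM (dyad_gt0 n) us hx hy.
apply: (@le_trans _ _ (\sum_(k <- s) 2 * (
    trig_laplace cos fr (z k).1 (z k).2 ^+ 2 + trig_laplace cos fi (z k).1 (z k).2 ^+ 2 +
    trig_laplace sin fr (z k).1 (z k).2 ^+ 2 + trig_laplace sin fi (z k).1 (z k).2 ^+ 2))).
  rewrite big_seq [leRHS]big_seq; apply: ler_sum => k ks.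
  have w0 : 0 < (z k).1 by case/andP : (hx _ ks) => + _; exact: lt_le_trans.
  rewrite (laplaceE w0 mr mi fM M0) -/fr -/fi.
  move: (trig_laplace cos fr _ _) (trig_laplace cos fi _ _)
    (trig_laplace sin fr _ _) (trig_laplace sin fi _ _) => a b c d /=.
  rewrite sqr_sqrtr ?addr_ge0 ?sqr_ge0//.
  have := sqr_ge0 (a - d); have := sqr_ge0 (b + c); lra.
rewrite -mulr_sumr !big_split/=.
have -> : K / dyad n ^+ 2 * M ^+ 2 =
  2 * (4 * (512 * expR 3 * expR 1 / dyad n ^+ 2 * M ^+ 2)) by rewrite /sieve_const; ring.
rewrite ler_pM2l//; move: b1 b2 b3 b4; rewrite -!/(trig_laplace _ _ _ _).
move: (512 * expR 3 * expR 1 / dyad n ^+ 2 * M ^+ 2) => Q b1 b2 b3 b4.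
have -> : 4 * Q = Q + Q + Q + Q by ring.
by apply: lerD => //; apply: lerD => //; apply: lerD.
Qed.

Variables (q : R) (hq : 2 <= q) (mu : {measure set (R * R) -> \bar R}).

(** Each box carries a point where [|L f|] is almost maximal. *)
Let near_max (n k : int) : exists z : R * R, box n (k%:~R * dyad n) z /\
  forall w, box n (k%:~R * dyad n) w -> N2 w <= 2 * N2 z.
Proof.
pose S := [set (N2 w)%:E | w in box n (k%:~R * dyad n)].
have S0 : S !=set0.
  exists (N2 (dyad n, k%:~R * dyad n))%:E; exists (dyad n, k%:~R * dyad n) => //.
  by split => /=; rewrite lexx/= ?ltrDl// dyadS mulr_natl mulr2n ltrDl.
have Sge0 x : S x -> (0 <= x)%E by move=> [w _ <-]; rewrite lee_fin sqr_ge0.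
have Sfin : (ereal_sup S < +oo)%E.
  apply: (@le_lt_trans _ _ (K / dyad n ^+ 2 * M ^+ 2)%:E); last exact: ltry.
  apply: ge_ereal_sup => _ [w bw <-]; rewrite lee_fin.
  have := @laplace_large_sieve n (fun=> w) [:: k] isT.
  by rewrite big_seq1; apply => j; rewrite inE => /eqP ->.
have [_ [z bz <-] hz] := ereal_sup_near S0 Sge0 Sfin.
exists z; split => // w bw; rewrite -lee_fin EFinM; apply: le_trans hz.
by apply: ereal_sup_ubound; exists w.
Qed.

(** On the strip [n] the transform is at most [sqrt (B n)] by the large sieve
    for one point. Hence [|L f| ^ q <= B n ^ (q / 2 - 1) |L f| ^ 2], and the
    large sieve for one point in each box of the strip bounds the sum of the
    squares. *)
Lemma laplace_integral_le :
  (\int[mu]_(w in Cplus) ((Normc.normc (laplace f (toC w))) `^ q)%:E <=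
   (2 * K `^ (q / 2) * M `^ q)%:E * dyadic_sum mu q)%E.
Proof.
have q2 : 0 <= q / 2 - 1 by rewrite subr_ge0 ler_pdivlMr// mul1r.
have q0 : 0 < q by rewrite (lt_le_trans _ hq).
have K0 : 0 <= K by exact: ltW sieve_const_gt0.
have /choice[zz hzz] : forall p : int * int, exists z : R * R,
    box p.1 (p.2%:~R * dyad p.1) z /\
    forall w, box p.1 (p.2%:~R * dyad p.1) w -> N2 w <= 2 * N2 z.
  by move=> [n k]; exact: near_max.
pose B n : R := K / dyad n ^+ 2 * M ^+ 2.
have B0 n : 0 <= B n.
  by apply: mulr_ge0; [apply: divr_ge0 => //; exact: sqr_ge0|exact: sqr_ge0].
have N2B n k w : box n (k%:~R * dyad n) w -> N2 w <= B n.
  move=> bw; have := @laplace_large_sieve n (fun=> w) [:: k] isT.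
  by rewrite big_seq1; apply => j; rewrite inE => /eqP ->.
pose g (p : int * int) : \bar R := (2 * B p.1 `^ (q / 2 - 1) * N2 (zz p))%:E.
have g0 p : (0 <= g p)%E.
  rewrite lee_fin; apply: mulr_ge0; last exact: sqr_ge0.
  by apply: mulr_ge0 => //; exact: powR_ge0.
pose Q (p : int * int) : set (R * R) := box p.1 (p.2%:~R * dyad p.1).
have normcE w : Normc.normc (laplace f (toC w)) `^ q = N2 w `^ (q / 2).
  have n0 : 0 <= Normc.normc (laplace f (toC w)) by case: (laplace _ _) => a b; exact: sqrtr_ge0.
  by rewrite -powR_mulrn// -powRrM mulrCA divff ?mulr1.
apply: (@le_trans _ _ (\esum_(p in [set: int * int]) (g p * mu (Q p)))%E).
  apply: integral_le_cover => //.
  - by move=> p; exact: measurable_box.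
  - move=> w w0; have [n nw] := dyad_ex w0.
    by have [k kw] := strip_box nw; exists (n, k).
  - by move=> w _; rewrite lee_fin powR_ge0.
  - move=> [n k] w _ bw; rewrite lee_fin normcE.
    have [_ /(_ _ bw) h] := hzz (n, k).
    apply: (@le_trans _ _ (B n `^ (q / 2 - 1) * N2 w)); last first.
      rewrite [leRHS](_ : _ = B n `^ (q / 2 - 1) * (2 * N2 (zz (n, k)))).
        by apply: ler_wpM2l => //; exact: powR_ge0.
      by rewrite /=; ring.
    rewrite -(mulr_powRB1 (sqr_ge0 _)) ?divr_gt0// mulrC.
    apply: ler_wpM2r; first exact: sqr_ge0.
    by rewrite ge0_ler_powR// ?nnegrE ?sqr_ge0//; exact: N2B bw.
rewrite esum_pair; last by move=> p; rewrite mule_ge0.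
have C0 : (0 <= (2 * K `^ (q / 2) * M `^ q)%:E)%E.
  rewrite lee_fin; apply: mulr_ge0; last exact: powR_ge0.
  by apply: mulr_ge0 => //; exact: powR_ge0.
apply: le_trans (esumZl_le C0 (box_density_ge0 mu q)).
apply: le_esum => n _.
apply: (@le_trans _ _ (\esum_(k in [set: int]) (g (n, k) * box_mass mu n))%E).
  by apply: le_esum => k _; apply: lee_wpmul2l => //; exact: box_le_mass.
apply: le_trans (esumZr_le (box_mass_ge0 _ _) _) _ => //.
rewrite /box_density muleA; apply: lee_wpmul2r; first exact: box_mass_ge0.
apply: esum_le_seq => l ul; rewrite /g sumEFin -EFinM lee_fin.
under eq_bigr do rewrite [X in X * _]/= -/(B n).
rewrite -mulr_sumr.
have hs : \sum_(k <- l) N2 (zz (n, k)) <= B n.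
  by apply: laplace_large_sieve => // k _; have [] := hzz (n, k).
have Bq : B n `^ (q / 2) = K `^ (q / 2) * M `^ q * dyad n `^ (- q).
  have d0 : 0 <= (dyad n ^+ 2)^-1 :> R by rewrite invr_ge0 sqr_ge0.
  rewrite /B (powRM _ (mulr_ge0 K0 d0) (sqr_ge0 _)) (powRM _ K0 d0).
  rewrite -(powR_mulrn _ M0) -powRrM mulrCA divff ?mulr1//.
  rewrite -(powR_inv1 (sqr_ge0 _)) -(powR_mulrn _ (dyad_ge0 n)) -!powRrM.
  rewrite mulrAC; congr (_ * _ * (_ `^ _)).
  by field.
have -> : 2 * K `^ (q / 2) * M `^ q * dyad n `^ (- q) = 2 * B n `^ (q / 2).
  by rewrite Bq; ring.
have q20 : 0 < q / 2 by rewrite divr_gt0.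
rewrite -(mulr_powRB1 (B0 n) q20) (mulrC (B n)) (mulrA 2).
by apply: ler_wpM2l => //; apply: mulr_ge0 => //; exact: powR_ge0.
Qed.

End laplace_upper.

Section laplace_opnorm_upper.
Context {R : realType}.
Implicit Types (mu : {measure set (R * R) -> \bar R}) (q : R).
Local Notation leb := (@lebesgue_measure R).

Lemma cLnorm_powR d (T : measurableType d) (mu : {measure set T -> \bar R}) (D : set T)
    (q : R) (g : T -> R[i]) : 0 < q ->
  (cLnorm mu D q%:E g `^ q = \int[mu]_(x in D) (Normc.normc (g x) `^ q)%:E)%E.
Proof.
move=> q0; rewrite /cLnorm poweR_Lnorm ?gt_eqF// [RHS]integral_mkcond.
apply: eq_integral => x _; rewrite /patch; case: ifPn => _ /=.
  by rewrite ger0_norm//; case: (g x) => a b; exact: sqrtr_ge0.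
by rewrite normr0 powR0// gt_eqF.
Qed.

Lemma laplace_opnorm_ge0 mu q : (0 <= laplace_opnorm mu q)%E.
Proof. by apply: le_ereal_inf_tmp => _ [M [M0 _] <-]; rewrite lee_fin. Qed.

Lemma poweR_ler (a b : \bar R) q : 0 <= q -> (0 <= a)%E -> (a <= b)%E -> (a `^ q <= b `^ q)%E.
Proof.
move=> q0 a0 ab; apply: gt0_ler_poweR => //; rewrite in_itv/= leey andbT//.
exact: le_trans ab.
Qed.

(** The constant in the upper bound for the [q]-th power of the norm of the
    embedding. *)
Definition embed_const q : R := 2 * sieve_const `^ (q / 2).

Lemma embed_const_gt0 q : 0 < embed_const q.
Proof. by rewrite /embed_const mulr_gt0// powR_gt0// sieve_const_gt0. Qed.

Variables (q : R) (hq : 2 <= q) (mu : {measure set (R * R) -> \bar R}).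
Let q0 : 0 < q. Proof. exact: lt_le_trans hq. Qed.

Lemma laplace_bounded_by_dyadic : (dyadic_sum mu q < +oo)%E ->
  laplace_bounded_by mu q ((embed_const q * fine (dyadic_sum mu q)) `^ q^-1).
Proof.
move=> Doo f hf; have [M [M0 NM fM]] := cLspace_oo_bound hf.
have [[mr mi] _] := hf.
have D0 := dyadic_sum_ge0 mu q.
have Dfin : dyadic_sum mu q \is a fin_num by rewrite ge0_fin_numE.
have fD0 : 0 <= fine (dyadic_sum mu q) by exact: fine_ge0.
have c0 := ltW (embed_const_gt0 q).
have := laplace_integral_le M0 mr mi fM hq mu.
rewrite -(cLnorm_powR _ _ _ q0) -/(embed_const q) -{1}(fineK Dfin) -EFinM => h.
have h' : (cLnorm mu Cplus q%:E (fun w => laplace f (toC w)) <=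
    ((embed_const q * fine (dyadic_sum mu q)) `^ q^-1)%:E * M%:E)%E.
  have N0 : (0 <= cLnorm mu Cplus q%:E (fun w => laplace f (toC w)))%E by exact: Lnorm_ge0.
  have := poweR_ler (ltW (_ : 0 < q^-1)) (poweR_ge0 _ _) h.
  rewrite -poweRrM mulfV ?gt_eqF// poweRe1// invr_gt0 => /(_ q0) /le_trans; apply.
  have cD : 0 <= embed_const q * fine (dyadic_sum mu q) by exact: mulr_ge0.
  rewrite /= -EFinM lee_fin mulrAC (powRM _ cD (powR_ge0 _ _)).
  by rewrite -[in X in _ * X]powRrM mulfV ?gt_eqF// powRr1.
split; last by rewrite NM.
split; first exact: cmeasurable_laplace M0 mr mi fM.
by apply: le_lt_trans h' _; rewrite -EFinM ltry.
Qed.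

Lemma laplace_opnorm_le : (laplace_opnorm mu q `^ q <= (embed_const q)%:E * dyadic_sum mu q)%E.
Proof.
have c0 := embed_const_gt0 q; have D0 := dyadic_sum_ge0 mu q.
have [Doo|] := ltP (dyadic_sum mu q) +oo%E; last first.
  by rewrite leye_eq => /eqP ->; rewrite gt0_muley ?lte_fin// leey.
have Dfin : dyadic_sum mu q \is a fin_num by rewrite ge0_fin_numE.
have fD0 : 0 <= fine (dyadic_sum mu q) by exact: fine_ge0.
apply: (@le_trans _ _ (((embed_const q * fine (dyadic_sum mu q)) `^ q^-1)%:E `^ q)%E).
  apply: poweR_ler; [exact: ltW|exact: laplace_opnorm_ge0|].
  apply: ereal_inf_lbound; exists ((embed_const q * fine (dyadic_sum mu q)) `^ q^-1) => //.
  by split; [exact: powR_ge0|exact: laplace_bounded_by_dyadic].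
rewrite /= -powRrM mulVf ?gt_eqF// (powRr1 (mulr_ge0 (ltW c0) fD0)).
by rewrite EFinM fineK.
Qed.

End laplace_opnorm_upper.
(** * The dyadic sum from the embedding bound *)

Section lacunary.
Context {R : realType}.
Local Notation leb := (@lebesgue_measure R).
Implicit Types (n k : int) (s : seq int) (y : int -> R) (t : R).

Lemma expR1_le4 : expR 1 <= 4 :> R.
Proof.
have h : 2^-1 <= expR (- 2^-1) :> R by have := expR_ge1Dx (- 2^-1 : R); lra.
have e2 : expR 2^-1 <= 2 :> R.
  by rewrite -(opprK 2^-1) expRN -[leRHS]invrK lef_pV2// posrE ?expR_gt0.
have -> : expR 1 = expR 2^-1 * expR 2^-1 :> R by rewrite -expRD; congr expR; lra.
have -> : 4 = 2 * 2 :> R by lra.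
by apply: ler_pM; rewrite ?expR_ge0.
Qed.

Lemma cos_ge_half (u : R) : 0 <= u <= 2^-1 -> 2^-1 <= cos u.
Proof.
move=> /andP[u0 u1]; move: u0; rewrite le_eqVlt => /orP[/eqP <-|u0]; first by rewrite cos0; lra.
have dc x : x \in `]0, u[ -> is_derive x 1 (@cos R) (- sin x) by move=> _; exact: is_derive_cos.
have cc : {within `[0, u], continuous (@cos R)}.
  by apply: continuous_subspaceT; exact: continuous_cos.
have [c _ cE] := MVT u0 dc cc.
have : - sin c * (u - 0) >= - 2^-1.
  have := sin_le1 c; rewrite ler_norml => /andP[h1 h2].
  rewrite subr0; nra.
by move: cE; rewrite cos0; lra.
Qed.

(** The times [t] with [1 / 4 <= 2 ^ n t < 1 / 2], on which the kernel of the
    transform neither decays nor oscillates within a box of the strip [n]. *)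
Definition time_piece n : set R := `[dyad (- n - 2), dyad (- n - 1)[%classic.

Lemma measurable_time_piece n : measurable (time_piece n : set (measurableTypeR R)).
Proof. exact: measurable_itv. Qed.

Lemma time_pieceE n t : time_piece n t <-> dyad (- n - 2) <= t < dyad (- n - 1).
Proof. by rewrite /time_piece/= in_itv. Qed.

Lemma time_piece_ex t : 0 < t -> exists n, time_piece n t.
Proof.
move=> /dyad_ex [n hn]; exists (- n - 2); apply/time_pieceE.
have -> : - (- n - 2) - 2 = n by lia.
by have -> : - (- n - 2) - 1 = n + 1 by lia.
Qed.

Lemma time_piece_uniq n k t : time_piece n t -> time_piece k t -> n = k.
Proof.
move=> /time_pieceE hn /time_pieceE hk.
have : - n - 2 = - k - 2.
  apply: (@dyad_uniq R t).
    by have -> : - n - 2 + 1 = - n - 1 by lia.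
  by have -> : - k - 2 + 1 = - k - 1 by lia.
lia.
Qed.

(** The sum of the modulations [T (y k t)], each cut off to its time piece. *)
Definition lacunary (T : R -> R) s y t : R :=
  \sum_(k <- s) \1_(time_piece k) t * T (y k * t).

Lemma sum_time_piece s (F : int -> R) n t : uniq s -> time_piece n t ->
  \sum_(k <- s) \1_(time_piece k) t * F k = if n \in s then F n else 0.
Proof.
move=> us nt.
have z k : k != n -> \1_(time_piece k) t * F k = 0.
  move=> kn; rewrite indicE memNset ?mul0r// => kt.
  by move/eqP : kn; apply; exact: time_piece_uniq kt nt.
case: ifPn => ns; last first.
  rewrite big_seq big1// => k ks; apply: z; apply: contraNneq ns => <-//.
by rewrite (bigD1_seq n)//= big1// addr0 indicE mem_set// mul1r.
Qed.

Lemma lacunary_le1 T s y t : (forall u, `|T u| <= 1) -> uniq s -> `|lacunary T s y t| <= 1.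
Proof.
move=> T1 us; have [[n nt]|h] := pselect (exists n, time_piece n t).
  rewrite /lacunary (sum_time_piece (fun k => T (y k * t)) us nt).
  by case: ifP => _ //; rewrite normr0.
rewrite /lacunary big1 ?normr0// => k _; rewrite indicE memNset ?mul0r// => kt.
by apply: h; exists k.
Qed.

Lemma lacunary_normc s y t : uniq s ->
  Normc.normc (lacunary cos s y t +i* lacunary sin s y t)%C <= 1.
Proof.
move=> us /=; rewrite -[leRHS]sqrtr1 ler_wsqrtr//.
have [[n nt]|h] := pselect (exists n, time_piece n t).
  rewrite /lacunary (sum_time_piece (fun k => cos (y k * t)) us nt).
  rewrite (sum_time_piece (fun k => sin (y k * t)) us nt).
  case: ifP => _; last by rewrite expr0n/= addr0.
  by rewrite cos2Dsin2.
by rewrite /lacunary !big1 ?expr0n/= ?addr0// => k _; rewrite indicE memNset ?mul0r// => kt;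
  apply: h; exists k.
Qed.

Lemma measurable_lacunary T s y (D : set (measurableTypeR R)) : continuous T ->
  measurable_fun D (lacunary T s y).
Proof.
move=> cT; apply: measurable_funTS; apply: measurable_sum => k.
apply: measurable_funM; first exact: measurable_indic (measurable_time_piece k).
apply: continuous_measurable_fun => t.
apply: (@continuous_comp _ _ _ (fun t => y k * t) T); last exact: cT.
by apply: cvgMr; exact: cvg_id.
Qed.

(** Distinct members of [s] differ by at least [16], which is enough for the
    interaction of distinct pieces to be negligible. *)
Definition separated s : Prop :=
  forall m n, m \in s -> n \in s -> m != n -> (n + 16 <= m) \/ (m + 16 <= n).

(** A lower bound for the kernel paired with the test function. *)
Let minorant n t : R := 8^-1 * \1_(time_piece n) t +
  (- 1 * \1_(`]0, dyad (- n - 17)[%classic) t + - (1 + dyad 13)^-1 * expR (- (dyad n / 2) * t)).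

(** On the box over the height [y n], the piece [n] of the test function
    resonates with the kernel. The pieces of larger index live on a short
    interval near [0], and on those of smaller index the kernel is small, since
    [expR (- 2 ^ 13) <= (1 + 2 ^ 13)^-1]. *)
Let minorant_le n s y w t : uniq s -> separated s -> n \in s -> box n (y n) w -> 0 < t ->
  minorant n t <=
  lacunary cos s y t * trig_exp cos w.1 w.2 t + lacunary sin s y t * trig_exp sin w.1 w.2 t.
Proof.
move=> us sep ns [/andP[x1 x2] /andP[y1 y2]] t0.
have [k kt] := time_piece_ex t0.
rewrite /lacunary (sum_time_piece (fun k => cos (y k * t)) us kt).
rewrite (sum_time_piece (fun k => sin (y k * t)) us kt).
have I0 (A : set R) : 0 <= \1_A t :> R by rewrite indicE.
have eh := expR_ge0 (- (dyad n / 2) * t).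
have d0 : 0 < dyad n :> R by exact: dyad_gt0.
have ce : 0 <= (1 + dyad 13)^-1 * expR (- (dyad n / 2) * t).
  by rewrite mulr_ge0// invr_ge0 addr_ge0.
rewrite /minorant.
have Jn : k != n -> \1_(time_piece n) t = 0 :> R.
  move=> kn; rewrite indicE memNset// => nt; move/eqP: kn; apply.
  exact: time_piece_uniq kt nt.
case: ifPn => ks; last first.
  have /Jn -> : k != n by apply: contraNneq ks => ->.
  by rewrite !mul0r mulr0 addr0; have := I0 `]0, dyad (- n - 17)[%classic; lra.
have -> : cos (y k * t) * trig_exp cos w.1 w.2 t + sin (y k * t) * trig_exp sin w.1 w.2 t =
    expR (- w.1 * t) * cos ((w.2 - y k) * t).
  by rewrite /trig_exp mulrBl cosB; ring.
have := I0 `]0, dyad (- n - 17)[%classic.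
have [kn|kn] := eqVneq k n.
  rewrite kn in kt *; move/time_pieceE : (kt) => /andP[t1 t2].
  rewrite (_ : \1_(time_piece n) t = 1); last by rewrite indicE mem_set.
  move=> i0.
  have tE : dyad n * t < 2^-1.
    rewrite -ltr_pdivlMl//; apply: lt_le_trans t2 _.
    have -> : - n - 1 = 0 - (n + 1) by rewrite sub0r opprD.
    by rewrite dyadB dyad0 dyadS mul1r invfM mulrC.
  have e1 : 4^-1 <= expR (- w.1 * t).
    apply: (@le_trans _ _ (expR (- 1))).
      by rewrite expRN lef_pV2 ?posrE ?expR_gt0// expR1_le4.
    rewrite ler_expR mulNr lerN2; rewrite dyadS in x2; nra.
  have c1 : 2^-1 <= cos ((w.2 - y n) * t).
    by apply: cos_ge_half; apply/andP; split; nra.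
  by nra.
rewrite (Jn kn) => i0.
move/time_pieceE : (kt) => /andP[t1 t2].
have c1 := cos_geN1 ((w.2 - y k) * t).
have E1 : 0 <= expR (- w.1 * t) <= 1.
  by rewrite expR_ge0 -expR0 ler_expR mulNr oppr_le0 mulr_ge0 ?(ltW t0)// (le_trans _ x1)// ltW.
case: (sep _ _ ks ns kn) => hk.
  rewrite (_ : \1_(`]0, dyad (- n - 17)[%classic) t = 1); last first.
    rewrite indicE mem_set//= in_itv/= t0/=; apply: lt_le_trans t2 _.
    by apply: le_dyad; clear -hk; lia.
  by nra.
have t3 : dyad 14 <= dyad n * t.
  rewrite -ler_pdivrMl//; apply: le_trans _ t1.
  by rewrite mulrC -dyadB; apply: le_dyad; clear -hk; lia.
have E2 : expR (- w.1 * t) <= (1 + dyad 13)^-1 * expR (- (dyad n / 2) * t).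
  apply: (@le_trans _ _ (expR (- (dyad n * t / 2)) * expR (- (dyad n / 2) * t))).
    by rewrite -expRD ler_expR; nra.
  have d13 : 0 < 1 + dyad 13 :> R by rewrite addr_gt0 ?dyad_gt0.
  apply: ler_wpM2r => //; rewrite expRN lef_pV2 ?posrE ?expR_gt0//.
  have := expR_ge1Dx (dyad n * t / 2).
  by have := @dyadS R 13; lra.
by nra.
Qed.

Let Rintegral_indic (i : interval R) : [set` i] `<=` posreals ->
  \int[leb]_(t in posreals) \1_([set` i]) t = fine (leb [set` i]).
Proof.
move=> h; rewrite /Rintegral integral_indic//; first by rewrite setIidl.
exact: measurable_posreals.
Qed.

Let integrable_indic_posreals (a b : R) (b0 b1 : bool) :
  leb.-integrable posreals (EFin \o \1_([set` Interval (BSide b0 a) (BSide b1 b)])).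
Proof.
apply: integrableS (integrable_indic_itv a b b0 b1) => //.
exact: measurable_posreals.
Qed.

Let integrable_minorant n : leb.-integrable posreals (EFin \o minorant n).
Proof.
have mD := @measurable_posreals R.
have h0 : 0 < dyad n / 2 :> R by rewrite divr_gt0 ?dyad_gt0.
have i1 := integrableZl mD 8^-1 (integrable_indic_posreals (dyad (- n - 2)) (dyad (- n - 1)) true true).
have i2 := integrableZl mD (-1) (integrable_indic_posreals 0 (dyad (- n - 17)) false true).
have i3 := integrableZl mD (- (1 + dyad 13)^-1) (integrable_expR_posreals h0).
exact: (integrableD mD i1 (integrableD mD i2 i3)).
Qed.

Let Rintegral_minorant n : (64 * dyad n)^-1 <= \int[leb]_(t in posreals) minorant n t.
Proof.
have mD := @measurable_posreals R.
have dn := @dyad_gt0 R n.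
have h0 : 0 < dyad n / 2 :> R by rewrite divr_gt0.
have j1 := integrable_indic_posreals (dyad (- n - 2)) (dyad (- n - 1)) true true.
have j2 := integrable_indic_posreals 0 (dyad (- n - 17)) false true.
have j3 := integrable_expR_posreals h0.
have i1 := integrableZl mD 8^-1 j1.
have i2 := integrableZl mD (-1) j2.
have i3 := integrableZl mD (- (1 + dyad 13)^-1) j3.
rewrite /minorant (RintegralD mD i1 (integrableD mD i2 i3)) (RintegralD mD i2 i3).
rewrite (RintegralZl _ mD j1) (RintegralZl _ mD j2) (RintegralZl _ mD j3).
rewrite !Rintegral_indic; last 2 first.
- by move=> t; rewrite /= in_itv/= => /andP[t0 _]; apply/posreals_gt0.
- move=> t; rewrite /= in_itv/= => /andP[t0 _]; apply/posreals_gt0.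
  exact: lt_le_trans (dyad_gt0 _) t0.
have := Rintegral_expR_posreals h0; move: (\int[leb]_(t in _) _) => I hI.
have dyE (j : int) : dyad (- n - j) = dyad (- j) / dyad n :> R.
  by rewrite addrC dyadB.
rewrite !lebesgue_measure_itv/= !lte_fin lt_dyad; last by clear; lia.
rewrite dyad_gt0/= !dyE oppr0 addr0.
have I0 : I <= 16 / dyad n.
  apply: le_trans hI _; rewrite invfM invrK mulrA mulrAC.
  apply: ler_wpM2r; first by rewrite invr_ge0 ltW.
  by have := expR1_le4; lra.
have T0 : 0 < 1 + dyad 13 :> R by rewrite addr_gt0// dyad_gt0.
have c16 : 16 / (1 + dyad 13) <= 128^-1 :> R.
  have : dyad 13 = 2 ^+ 13 :> R by [].
  by rewrite ler_pdivrMr//; lra.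
have u0 : 0 < (dyad n)^-1 :> R by rewrite invr_gt0.
have cI : (1 + dyad 13)^-1 * I <= 128^-1 / dyad n.
  apply: (@le_trans _ _ ((1 + dyad 13)^-1 * (16 / dyad n))).
    by apply: ler_wpM2l => //; rewrite invr_ge0 ltW.
  by rewrite mulrA [X in X / _]mulrC ler_wpM2r// ltW.
have d1 : dyad (- 1) = 2^-1 :> R by rewrite /dyad exprN1.
have d2 : dyad (- 2) = 4^-1 :> R.
  by rewrite (_ : -2 = -1 - 1)// dyadD d1; lra.
have d17 : dyad (- 17) <= 256^-1 :> R.
  have : dyad (-17) <= dyad (-8) :> R by apply: le_dyad.
  have e4 : dyad (-4) = 4^-1 * 4^-1 :> R by rewrite -d2 -dyadD.
  by have -> : dyad (-8) = dyad (-4) * dyad (-4) :> R by [rewrite -dyadD]; rewrite e4; lra.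
have d17u := ler_wpM2r (ltW u0) d17.
rewrite invfM d1 d2; lra.
Qed.

(** The test function takes the value [exp (i (y k) t)] on the piece of times
    attached to [k]. *)
Definition lacunary_test s y t : R[i] := (lacunary cos s y t +i* lacunary sin s y t)%C.

Lemma laplace_lacunary_ge n s y (w : R * R) : uniq s -> separated s -> n \in s ->
  box n (y n) w -> (64 * dyad n)^-1 <= Normc.normc (laplace (lacunary_test s y) (toC w)).
Proof.
move=> us sep ns bw.
have w0 : 0 < w.1 by have := box_Cplus bw.
have mD := @measurable_posreals R.
have cc := @continuous_cos R. have cs := @continuous_sin R.
have mr : measurable_fun (posreals : set (measurableTypeR R))
  (fun t => complex.Re (lacunary_test s y t)) by exact: measurable_lacunary cc.
have mi : measurable_fun (posreals : set (measurableTypeR R))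
  (fun t => complex.Im (lacunary_test s y t)) by exact: measurable_lacunary cs.
have f1 : \forall t \ae leb, posreals t -> Normc.normc (lacunary_test s y t) <= 1.
  by apply: aeW => t _; exact: lacunary_normc.
rewrite (laplaceE w0 mr mi f1 ler01).
have -> : clip 1 (fun t => complex.Re (lacunary_test s y t)) = lacunary cos s y.
  by apply/funext => t; apply: clip_id; exact: lacunary_le1 cos_le1 us.
have -> : clip 1 (fun t => complex.Im (lacunary_test s y t)) = lacunary sin s y.
  by apply/funext => t; apply: clip_id; exact: lacunary_le1 sin_le1 us.
have i1 := integrable_trig_laplace cc cos_le1 w.2 w0 mr (fun t _ => lacunary_le1 y t cos_le1 us).
have i2 := integrable_trig_laplace cs sin_le1 w.2 w0 mi (fun t _ => lacunary_le1 y t sin_le1 us).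
rewrite /= -/(lacunary _ _ _); set b := _ - _.
apply: (@le_trans _ _ (trig_laplace cos (lacunary cos s y) w.1 w.2 +
                       trig_laplace sin (lacunary sin s y) w.1 w.2)); last first.
  apply: le_trans (ler_norm _) _; rewrite -sqrtr_sqr ler_wsqrtr// lerDl.
  exact: sqr_ge0.
rewrite /trig_laplace -(RintegralD mD i1 i2).
apply: le_trans (Rintegral_minorant n) _; apply: le_Rintegral => //.
- exact: (integrableD mD i1 i2).
- by move=> t /posreals_gt0 t0; apply: minorant_le bw t0.
Qed.

Lemma cLnorm_lacunary_test s y : uniq s ->
  cLspace leb posreals +oo%E (lacunary_test s y) /\
  (cLnorm leb posreals +oo%E (lacunary_test s y) <= 1)%E.
Proof.
move=> us.
have N1 : (cLnorm leb posreals +oo%E (lacunary_test s y) <= 1)%E.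
  rewrite /cLnorm unlock /= lebesgue_setT_gt0; apply/ess_supP; apply: aeW => t /=.
  rewrite /patch; case: ifPn => _ /=; last by rewrite normr0 lee_fin.
  rewrite lee_fin ger0_norm; first exact: lacunary_normc.
  exact: sqrtr_ge0.
split => //; split; last by rewrite (le_lt_trans N1)// ltry.
by split; apply: measurable_lacunary; [exact: continuous_cos|exact: continuous_sin].
Qed.

End lacunary.

Section laplace_lower.
Context {R : realType}.
Variables (q : R) (hq : 2 <= q) (mu : {measure set (R * R) -> \bar R}) (M : R).
Context (M0 : 0 <= M) (bM : laplace_bounded_by mu q M).
Let q0 : 0 < q. Proof. exact: lt_le_trans hq. Qed.

(** The test function is large on all the boxes simultaneously. *)
Let separated_boxes s (y : int -> R) : uniq s -> separated s ->
  (\sum_(n <- s) ((dyad n `^ (- q))%:E * mu (box n (y n))) <= ((64 * M) `^ q)%:E)%E.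
Proof.
move=> us sep; have [hf f1] := @cLnorm_lacunary_test R s y us.
set f := lacunary_test s y in hf f1.
pose g n : \bar R := if n \in s then ((64 * dyad n)^-1 `^ q)%:E else 0%E.
have g0 n : (0 <= g n)%E by rewrite /g; case: ifP => // _; rewrite lee_fin powR_ge0.
have nn0 w : 0 <= Normc.normc (laplace f (toC w)).
  by case: (laplace _ _) => a b; exact: sqrtr_ge0.
have pack : (\esum_(n in [set: int]) (g n * mu (box n (y n))) <= (M `^ q)%:E)%E.
  apply: (@le_trans _ _ (\int[mu]_(w in Cplus) (Normc.normc (laplace f (toC w)) `^ q)%:E)%E).
    apply: packing_le_integral => //.
    - by move=> n; exact: measurable_box.
    - by move=> n; exact: box_Cplus.
    - by move=> m n w [+ _] [+ _]; exact: dyad_uniq.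
    - by move=> w _; rewrite lee_fin powR_ge0.
    - move=> n w bw; rewrite /g; case: ifPn => ns; last by rewrite lee_fin powR_ge0.
      rewrite lee_fin ge0_ler_powR ?nnegrE ?(ltW q0)//.
        by rewrite invr_ge0 mulr_ge0// dyad_ge0.
      exact: laplace_lacunary_ge bw.
  rewrite -(cLnorm_powR _ _ _ q0); have [_ hM] := bM hf.
  rewrite -[leRHS]/((M%:E) `^ q)%E; apply: poweR_ler (ltW q0) _ _; first exact: Lnorm_ge0.
  by apply: le_trans hM _; rewrite -[leRHS]mule1; apply: lee_wpmul2l.
have := le_trans (seq_le_esum _ us) pack.
rewrite (powRM _ _ M0)// EFinM => h.
apply: (@le_trans _ _ ((64 `^ q)%:E * \sum_(n <- s) (g n * mu (box n (y n))))%E); last first.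
  by apply: lee_wpmul2l h; rewrite lee_fin powR_ge0.
rewrite ge0_sume_distrr; last by move=> n _; rewrite mule_ge0.
rewrite big_seq [leRHS]big_seq; apply: lee_sum => n ns.
rewrite /g ns muleA -EFinM; apply: lee_wpmul2r => //; rewrite lee_fin.
rewrite -powRM ?invr_ge0 ?mulr_ge0 ?dyad_ge0// invfM mulrA mulfV ?pnatr_eq0// mul1r.
by rewrite -(powR_inv1 (dyad_ge0 n)) -powRrM mulN1r.
Qed.

Let box_mass_fin n : (box_mass mu n < +oo)%E.
Proof.
apply: (@le_lt_trans _ _ ((dyad n `^ q * (64 * M) `^ q)%:E)); last exact: ltry.
apply: ge_ereal_sup => _ [y _ <-].
have := @separated_boxes [:: n] (fun=> y) isT.
rewrite big_seq1 => h; have {}h := h _.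
rewrite EFinM -lee_pdivrMl ?powR_gt0 ?dyad_gt0// -powRN.
by apply: h => i j; rewrite !inE => /eqP -> /eqP ->; rewrite eqxx.
Qed.

Let separated_densities s : uniq s -> separated s ->
  (\sum_(n <- s) box_density mu q n <= (2 * (64 * M) `^ q)%:E)%E.
Proof.
move=> us sep.
have /choice[y hy] : forall n : int, exists y : R, (box_mass mu n <= 2%:E * mu (box n y))%E.
  move=> n; have [||_ [y _ <-] h] := @ereal_sup_near R [set mu (box n y) | y in [set: R]] _ _ (box_mass_fin n).
  - by exists (mu (box n 0)), 0.
  - by move=> _ [y _ <-].
  - by exists y.
rewrite EFinM.
apply: (@le_trans _ _ (2%:E * \sum_(n <- s) ((dyad n `^ (- q))%:E * mu (box n (y n))))%E).
  rewrite ge0_sume_distrr; last by move=> n _; rewrite mule_ge0// lee_fin powR_ge0.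
  apply: lee_sum => n _; rewrite muleCA; apply: lee_wpmul2l => //.
  by rewrite lee_fin powR_ge0.
by apply: lee_wpmul2l => //; exact: separated_boxes.
Qed.

(** A set of integers is the union of [16] separated ones, its residue
    classes. *)
Lemma dyadic_sum_le_bound : (dyadic_sum mu q <= (32 * 64 `^ q * M `^ q)%:E)%E.
Proof.
apply: esum_le_seq => s us.
pose p (n : int) : 'I_16 := inord `|(n %% 16)%Z|%N.
rewrite (partition_big p xpredT)//=.
apply: (@le_trans _ _ (\sum_(j < 16) (2 * (64 * M) `^ q)%:E)%E).
  apply: lee_sum => j _; rewrite -big_filter; apply: separated_densities.
    exact: filter_uniq.
  move=> m n; rewrite !mem_filter => /andP[/eqP hm _] /andP[/eqP hn _] mn.
  have : p m = p n by rewrite hm hn.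
  move=> /(congr1 (@nat_of_ord _)); rewrite !inordK; last 2 first.
  - by clear; have := @ltz_pmod n 16 isT; have := @modz_ge0 n 16 isT; lia.
  - by clear; have := @ltz_pmod m 16 isT; have := @modz_ge0 m 16 isT; lia.
  move: mn; clear => /eqP mn h.
  have := @modz_ge0 n 16 isT; have := @modz_ge0 m 16 isT.
  by have := divz_eq n 16; have := divz_eq m 16; lia.
rewrite sumEFin lee_fin sumr_const card_ord (powRM _ _ M0)//.
by move: (64 `^ q) (M `^ q) => a b; lra.
Qed.

End laplace_lower.

(** * The equivalence of the conditions *)

Section main_equivalence.
Context {R : realType}.
Variables (q : R) (hq : 2 <= q).
Let q0 : 0 < q. Proof. exact: lt_le_trans hq. Qed.

Lemma laplace_bounded_dyadic (mu : {measure set (R * R) -> \bar R}) :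
  laplace_bounded mu q <-> (dyadic_sum mu q < +oo)%E.
Proof.
split.
  move=> [M [M0 bM]]; apply: le_lt_trans (dyadic_sum_le_bound hq M0 bM) _.
  exact: ltry.
move=> Doo; exists ((embed_const q * fine (dyadic_sum mu q)) `^ q^-1).
by split; [exact: powR_ge0|exact: laplace_bounded_by_dyadic].
Qed.

Lemma dyadic_sum_equivalent :
  equivalent (fun mu : {measure set (R * R) -> \bar R} => dyadic_sum mu q)
    (fun mu => laplace_opnorm mu q `^ q)%E.
Proof.
have C0 : 0 < 32 * 64 `^ q :> R by apply: mulr_gt0; [rewrite ltr0n|apply: powR_gt0; rewrite ltr0n].
exists (32 * 64 `^ q), (embed_const q); split => //; first exact: embed_const_gt0.
move=> mu; split; last exact: laplace_opnorm_le.
(* The bound [x <= M ^ q] passes to the infimum over [M] after taking roots. *)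
rewrite -lee_pdivrMl//; set x := (_ * _)%E.
have x0 : (0 <= x)%E by rewrite mule_ge0 ?dyadic_sum_ge0// lee_fin invr_ge0 ltW.
have -> : x = ((x `^ q^-1) `^ q)%E by rewrite -poweRrM mulVf ?gt_eqF// poweRe1.
apply: poweR_ler (ltW q0) (poweR_ge0 _ _) _.
apply: le_ereal_inf_tmp => _ [M [M0 bM] <-].
have -> : M%:E = ((M%:E `^ q) `^ q^-1)%E.
  by rewrite -poweRrM mulfV ?gt_eqF// poweRe1.
apply: poweR_ler => //; first by rewrite invr_ge0 ltW.
rewrite /x lee_pdivrMl// -EFinM; exact: dyadic_sum_le_bound.
Qed.

End main_equivalence.

Section conclusion.
Context {R : realType}.
Implicit Types (F : {measure set (R * R) -> \bar R} -> \bar R).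

Lemma comparable_withW (c C c' C' : R) (a b : \bar R) : (0 <= a)%E ->
  c' <= c -> C <= C' -> comparable_with c C a b -> comparable_with c' C' a b.
Proof.
move=> a0 cc CC [h1 h2]; split.
  by apply: le_trans h1; apply: lee_wpmul2r => //; rewrite lee_fin.
by apply: le_trans h2 _; apply: lee_wpmul2r => //; rewrite lee_fin.
Qed.

Variables (q : R) (hq : 2 <= q).

Lemma equivalent_dyadic_ge0 F (mu : {measure set (R * R) -> \bar R}) :
  equivalent F (fun mu => dyadic_sum mu q) -> (0 <= F mu)%E.
Proof.
move=> [A [B [A0 B0 /(_ mu)[_ h]]]].
by have := le_trans (dyadic_sum_ge0 mu q) h; rewrite pmule_rge0.
Qed.

Lemma equivalent_laplace_bounded F (mu : {measure set (R * R) -> \bar R}) :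
  equivalent F (fun mu => dyadic_sum mu q) ->
  laplace_bounded mu q <-> (F mu < +oo)%E.
Proof.
move=> e; split.
  by move=> /(laplace_bounded_dyadic hq) h; exact: equivalent_fin (equivalent_sym e) h.
by move=> h; apply/(laplace_bounded_dyadic hq); exact: equivalent_fin e h.
Qed.

Lemma equivalent_opnorm F : equivalent F (fun mu => dyadic_sum mu q) ->
  exists c C : R, 0 < c /\ 0 < C /\ forall mu : {measure set (R * R) -> \bar R},
    (laplace_bounded mu q <-> (F mu < +oo)%E) /\
    comparable_with c C (F mu) (laplace_opnorm mu q `^ q)%E.
Proof.
move=> e.
have [c [C [c0 C0 h]]] := equivalent_comparable (equivalent_trans e (dyadic_sum_equivalent hq)).
exists c, C; split=> //; split=> // mu; split; first exact: equivalent_laplace_bounded.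
exact: h.
Qed.

End conclusion.

Theorem theorem2p3 (R : realType) (q : R) (hq : 2 <= q) :
  (exists c C : R, 0 < c /\ 0 < C /\
    forall mu : {measure set (R * R) -> \bar R}, regular_borel_on_Cplus mu ->
      (laplace_bounded mu q <-> (carleson_sum q mu < +oo)%E) /\
      (laplace_bounded mu q <-> (carleson_integral q mu < +oo)%E) /\
      comparable_with c C (carleson_sum q mu)
        (laplace_opnorm mu q `^ q)%E /\
      comparable_with c C (carleson_integral q mu)
        (laplace_opnorm mu q `^ q)%E) /\
  (forall alpha : R, -1 < alpha ->
    (q < 4 + 2 * alpha ->
      exists c C : R, 0 < c /\ 0 < C /\
      forall mu : {measure set (R * R) -> \bar R}, regular_borel_on_Cplus mu ->
        (laplace_bounded mu q <->
          (line_sup_integral q (berezin_tilde alpha mu) < +oo)%E) /\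
        comparable_with c C (line_sup_integral q (berezin_tilde alpha mu))
          (laplace_opnorm mu q `^ q)%E) /\
    (q < 4 + alpha ->
      exists c C : R, 0 < c /\ 0 < C /\
      forall mu : {measure set (R * R) -> \bar R}, regular_borel_on_Cplus mu ->
        (laplace_bounded mu q <->
          (line_sup_integral q (berezin alpha mu) < +oo)%E) /\
        comparable_with c C (line_sup_integral q (berezin alpha mu))
          (laplace_opnorm mu q `^ q)%E)).
Proof.
split.
  have e1 := carleson_sum_equivalent hq; have e2 := carleson_integral_equivalent hq.
  have [c1 [C1 [c10 [C10 h1]]]] := equivalent_opnorm hq e1.
  have [c2 [C2 [c20 [C20 h2]]]] := equivalent_opnorm hq e2.
  exists (Num.min c1 c2), (Num.max C1 C2).
  split; first by rewrite lt_min c10.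
  split; first by rewrite lt_max C10.
  move=> mu _; have [b1 k1] := h1 mu; have [b2 k2] := h2 mu.
  split=> //; split=> //; split.
    apply: comparable_withW k1; rewrite ?ge_min ?le_max ?lexx//.
    exact: equivalent_dyadic_ge0 e1.
  apply: comparable_withW k2; rewrite ?ge_min ?le_max ?lexx ?orbT//.
  exact: equivalent_dyadic_ge0 e2.
move=> alpha alpha1; split=> hqa.
  have [c [C [c0 [C0 h]]]] := equivalent_opnorm hq (berezin_tilde_equivalent hq alpha1 hqa).
  by exists c, C; split=> //; split=> // mu _.
have [c [C [c0 [C0 h]]]] := equivalent_opnorm hq (berezin_equivalent hq alpha1 hqa).
by exists c, C; split=> //; split=> // mu _.
Qed.
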